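(* Suppose there exist functions $\psi_j:\mathcal X\times\{1,\dots,n\}\to\mathbb R$, $j=1,\dots,p$, and constants $\{c_{i,\theta}\}$ such that for all $\theta,\tilde\theta\in\Theta_*$ and all $i=1,\dots,n$, $$\bigl|[\rho_\theta(X_i)-c_{i,\theta}]-[\rho_{\tilde\theta}(X_i)-c_{i,\tilde\theta}]\bigr|\le\sum_{j=1}^p|\theta_j-\tilde\theta_j|\,\psi_j(X_i,i).$$ Let $\psi:=(\psi_1,\dots,\psi_p)^T$ and $\Sigma_n:=\frac1n\sum_{i=1}^n\psi(X_i,i)\psi^T(X_i,i)$, let $\underline\Lambda_n^2$ be the smallest and $\bar\Lambda_n^2$ the largest eigenvalue of $\Sigma_n$ (with $\underline\Lambda_n,\bar\Lambda_n\ge0$), and assume $\underline\Lambda_n>0$. Let $K_n:=\max_{1\le j\le p}\|\psi_j\|_n$. Then, for a universal constant $C$ (not depending on any other quantity), $$\mathbb E\Bigl(\sup_{\theta\in\Theta_M(\theta^* )}|Y^\varepsilon(\theta,\theta^* )|\,\Big|\,\mathbf X\Bigr)\le C\,M\,\sqrt{\frac{2\log(2p)}{n}}\;K_n\;\frac{\bar\Lambda_n}{\underline\Lambda_n}.$$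
   Context: $X_1,\dots,X_n$ are independent random variables with values in a measurable space $\mathcal X$, and $\mathbf X:=(X_1,\dots,X_n)$. $\Theta\subset\mathbb R^p$ is a parameter space, and $\Theta_*$ is either $\Theta$ itself or the smallest convex set containing $\Theta$. For each $\theta\in\Theta_*$ a loss function $\rho_\theta:\mathcal X\to\mathbb R$ is given. The $c_{i,\theta}$ ($i=1,\dots,n$, $\theta\in\Theta_*$) are non-random real constants, and $\rho^c_\theta(X_i,i):=\rho_\theta(X_i)-c_{i,\theta}$. $\theta^*\in\Theta$ is fixed, and for $M>0$, with $\|\cdot\|_1$ the $\ell_1$-norm, $$\Theta_M(\theta^* ):=\{\theta\in\Theta_*:\ \|\theta-\theta^*\|_1\le M\}.$$ For $g:\mathcal X\times\{1,\dots,n\}\to\mathbb R$, $\|g\|_n^2:=\frac1n\sum_{i=1}^n g^2(X_i,i)$. $\varepsilon_1,\dots,\varepsilon_n$ is a Rademacher sequence (i.i.d., values $\pm1$ with probability $1/2$ each) independent of $\mathbf X$, and the symmetrized process is $$Y^\varepsilon(\theta,\theta^* ):=\frac1n\sum_{i=1}^n\varepsilon_i\bigl[\rho^c_\theta(X_i,i)-\rho^c_{\theta^*}(X_i,i)\bigr].$$ *)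

(* Defs.v *)
From HB Require Import structures.
From mathcomp Require Import all_boot all_order all_algebra.
From mathcomp Require Import all_classical all_reals all_analysis.
From mathcomp Require Import measurable_realfun.

Set Implicit Arguments.
Unset Strict Implicit.
Unset Printing Implicit Defensive.

Import Order.TTheory GRing.Theory Num.Theory.
Import numFieldNormedType.Exports.

Local Open Scope classical_set_scope.
Local Open Scope ring_scope.

Section Probability.
Context {d d' : measure_display} {Omega : measurableType d}
  {T : measurableType d'} {R : realType} (P : probability Omega R).

Definition mutually_independent (n : nat) (X : 'I_n -> Omega -> T) : Prop :=
  forall (J : {set 'I_n}) (B : 'I_n -> set T),
    (forall i, measurable (B i)) ->
    P (\bigcap_(i in [set` J]) (X i @^-1` B i)) =
    (\prod_(i in J) P (X i @^-1` B i))%E.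

Definition independent_systems (F G : set (set Omega)) : Prop :=
  forall A B, F A -> G B -> P (A `&` B) = (P A * P B)%E.

(* Z is a version of the conditional expectation of f given the
   sigma-algebra G.  Meant for an f that is nonnegative (f and Z may then take
   the value +oo, and the condition forces Z >= 0 almost surely) or
   integrable. *)
Definition is_cond_expectation (G : set (set Omega)) (f Z : Omega -> \bar R)
    : Prop :=
  (forall B : set (\bar R), measurable B -> G (Z @^-1` B)) /\
  (forall A, G A -> (\int[P]_(w in A) Z w = \int[P]_(w in A) f w)%E).

End Probability.

Definition rademacher {d : measure_display} {Omega : measurableType d}
    {R : realType} (P : probability Omega R) (n : nat)
    (eps : 'I_n -> Omega -> R) : Prop :=
  mutually_independent P eps /\
  forall i, P (eps i @^-1` [set 1]) = (2^-1)%:E /\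
            P (eps i @^-1` [set -1]) = (2^-1)%:E.

Section Euclidean.
Context {R : realType} {p : nat}.

Definition convex_hull (A : set 'rV[R]_p) : set 'rV[R]_p :=
  \bigcap_(B in [set B : set (convex_lmodType 'rV[R]_p) |
                  convex_set B /\ A `<=` B]) B.

Definition l1norm (v : 'rV[R]_p) : R := \sum_j `|v 0 j|.

Definition l1ball_in (S : set 'rV[R]_p) (v : 'rV[R]_p) (M : R)
    : set 'rV[R]_p :=
  [set u | S u /\ l1norm (u - v) <= M].

Definition is_smallest_eigenvalue (A : 'M[R]_p) (a : R) : Prop :=
  eigenvalue A a /\ forall b, eigenvalue A b -> a <= b.

Definition is_largest_eigenvalue (A : 'M[R]_p) (a : R) : Prop :=
  eigenvalue A a /\ forall b, eigenvalue A b -> b <= a.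

End Euclidean.

(* In this section x and e stand for realized values of (X_1, ..., X_n) and
   (eps_1, ..., eps_n). *)
Section Empirical.
Context {T : Type} {R : realType} {n p : nat}.

Definition empirical_norm (g : T -> 'I_n -> R) (x : 'I_n -> T) : R :=
  Num.sqrt (n%:R^-1 * \sum_(i < n) g (x i) i ^+ 2).

Definition compensated_loss (rho : 'rV[R]_p -> T -> R)
    (c : 'I_n -> 'rV[R]_p -> R) (theta : 'rV[R]_p) (y : T) (i : 'I_n) : R :=
  rho theta y - c i theta.

Definition symmetrized_process (rho : 'rV[R]_p -> T -> R)
    (c : 'I_n -> 'rV[R]_p -> R) (e : 'I_n -> R) (x : 'I_n -> T)
    (theta theta' : 'rV[R]_p) : R :=
  n%:R^-1 * \sum_(i < n) e i * (compensated_loss rho c theta (x i) i -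
                                compensated_loss rho c theta' (x i) i).

Definition psi_col (psi : 'I_p -> T -> 'I_n -> R) (y : T) (i : 'I_n)
    : 'cV[R]_p :=
  \col_j psi j y i.

Definition Sigma_mx (psi : 'I_p -> T -> 'I_n -> R) (x : 'I_n -> T) : 'M[R]_p :=
  n%:R^-1 *: \sum_(i < n) psi_col psi (x i) i *m (psi_col psi (x i) i)^T.

(* The default value 0 of the maximum is harmless, as norms are
   nonnegative. *)
Definition K_max (psi : 'I_p -> T -> 'I_n -> R) (x : 'I_n -> T) : R :=
  \big[Num.max/0]_(j < p) empirical_norm (psi j) x.

End Empirical.

(* Main.v *)
Require Import Defs.
From HB Require Import structures.
From mathcomp Require Import all_boot all_order all_algebra.
From mathcomp Require Import all_classical all_reals all_analysis.
From mathcomp Require Import measurable_realfun.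
From mathcomp Require Import ring lra zify.

Set Implicit Arguments.
Unset Strict Implicit.
Unset Printing Implicit Defensive.

Import Order.TTheory GRing.Theory Num.Theory.
Import numFieldNormedType.Exports.

Local Open Scope classical_set_scope.
Local Open Scope ring_scope.

(** Given X, the process is a Rademacher average indexed by theta whose
    increments are, by the Lipschitz hypothesis and the Rayleigh bound for
    Sigma_n, at most Lambda_max times the Euclidean distance.  As psi may take
    negative values there is no coordinatewise comparison to apply contraction
    to, and the supremum over the l1-ball is bounded by chaining.  Dudley's entropy integral would lose a
    factor log p there, so the cells of level s are adapted to the point: they
    fix, up to rounding, its 4^s largest coordinates, at the cost of about
    4^s log(2p) nats.  Their diameter is about the l2-norm of the other
    coordinates, and 2^s times this tail norm is summable over s, with a sum
    bounded by the l1-norm.  Hence the conditional mean is at most a multiple of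
    M Lambda_max sqrt(log(2p) / n), and K_n >= Lambda_min since a diagonal
    entry of Sigma_n is at least its smallest eigenvalue.

    By the Lipschitz hypothesis the supremum is almost surely a supremum over a
    countable dense set of parameters.  On an event of sigma(X) where the
    process is at most r_e for every sign pattern e, the conditional expectation
    is at most the mean of the r_e, by independence of the signs and X. *)

(** * Rademacher sums *)

Section SignSums.
Context {R : realType} {n : nat}.
Implicit Types (b : 'I_n -> R) (e : {ffun 'I_n -> bool}) (l a x : R).

Definition sign_sum e b : R := \sum_i (-1) ^+ e i * b i.

(** The mean over independent fair signs as a finite average, so that no integration occurs while X
    is fixed. *)
Definition sign_avg (U : {ffun 'I_n -> bool} -> R) : R :=
  2^-1 ^+ n * \sum_e U e.

Lemma sign_avg_le U V : (forall e, U e <= V e) -> sign_avg U <= sign_avg V.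
Proof.
move=> UV; rewrite ler_wpM2l ?exprn_ge0 ?invr_ge0 ?ler0n //.
exact: ler_sum.
Qed.

Lemma sign_avg_cst a : sign_avg (fun=> a) = a.
Proof.
rewrite /sign_avg sumr_const card_ffun card_bool card_ord -[a *+ _]mulr_natr.
by rewrite natrX mulrCA -exprMn mulVf ?pnatr_eq0// expr1n mulr1.
Qed.

Lemma sign_avgD U V : sign_avg (U \+ V) = sign_avg U + sign_avg V.
Proof. by rewrite /sign_avg big_split mulrDr. Qed.

Lemma sign_avgZ a U : sign_avg (fun e => a * U e) = a * sign_avg U.
Proof. by rewrite /sign_avg -mulr_sumr mulrCA. Qed.

Lemma sign_avg_sum (I : Type) (r : seq I) (F : I -> {ffun 'I_n -> bool} -> R) :
  sign_avg (fun e => \sum_(i <- r) F i e) = \sum_(i <- r) sign_avg (F i).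
Proof. by rewrite /sign_avg exchange_big/= mulr_sumr. Qed.

(** For [x ^+ 2 <= 1 / 2], the bound [expR y <= (1 - y)^-1] at [x] and [- x] sums to
    [2 / (1 - x ^+ 2)], which is at most [2 * (1 + 2 * x ^+ 2)]. For larger [x] each exponent is
    itself at most [2 * x ^+ 2]. *)
Lemma expR_cosh_le x : expR x + expR (- x) <= 2 * expR (2 * x ^+ 2).
Proof.
have [x2|x2] := leP (x ^+ 2) 2^-1.
  have inv_bound (y : R) : y < 1 -> expR y <= (1 - y)^-1.
    move=> y1; rewrite -[y]opprK expRN lef_pV2 ?posrE ?expR_gt0 ?opprK//; last by lra.
    exact: expR_ge1Dx.
  have h1 : 0 < 1 - x ^+ 2 by lra.
  have x1 : x < 1 by have := sqr_ge0 (x - 1); lra.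
  have x1' : - x < 1 by have := sqr_ge0 (x + 1); lra.
  apply: (@le_trans _ _ ((1 - x)^-1 + (1 - - x)^-1)); first by rewrite lerD ?inv_bound.
  have -> : (1 - x)^-1 + (1 - - x)^-1 = 2 * (1 - x ^+ 2)^-1.
    by field; apply/and3P; split; apply/eqP; nra.
  rewrite ler_pM2l ?ltr0n//.
  have := expR_ge1Dx (2 * x ^+ 2).
  set E := expR _ => hE.
  by rewrite -(@ler_pM2r _ (1 - x ^+ 2))// mulVf ?gt_eqF//; nra.
suff h (y : R) : y ^+ 2 = x ^+ 2 -> expR y <= expR (2 * x ^+ 2).
  by rewrite [2 * expR _]mulr_natl mulr2n lerD ?h ?sqrrN.
move=> yx; rewrite -yx ler_expR in x2 *; have := sqr_ge0 (2 * y - 1); nra.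
Qed.

(** The exponential of the sum is a product, so the average factorizes over the coordinates, and
    each factor is a hyperbolic cosine. *)
Lemma sign_avg_expR l b :
  sign_avg (fun e => expR (l * sign_sum e b))
    <= expR (2 * l ^+ 2 * \sum_i b i ^+ 2).
Proof.
rewrite /sign_avg.
have -> : \sum_e expR (l * sign_sum e b) =
    \prod_(i < n) \sum_(s : bool) expR ((-1) ^+ s * (l * b i)).
  rewrite bigA_distr_bigA; apply: eq_bigr => e _.
  rewrite /sign_sum mulr_sumr expR_sum; apply: eq_bigr => i _.
  by rewrite mulrCA.
rewrite mulr_sumr expR_sum -[X in _ ^+ X]card_ord -prodr_const -big_split /=.
apply: ler_prod => i _; rewrite big_bool /= expr1 expr0 mulN1r mul1r.
rewrite mulr_ge0 ?invr_ge0 ?ler0n ?addr_ge0 ?expR_ge0 //=.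
rewrite ler_pdivrMl ?ltr0n// addrC.
by rewrite -mulrA -exprMn; exact: expR_cosh_le.
Qed.

Lemma sign_avg_expR_abs l b : 0 <= l ->
  sign_avg (fun e => expR (l * `|sign_sum e b|))
    <= 2 * expR (2 * l ^+ 2 * \sum_i b i ^+ 2).
Proof.
move=> l0; rewrite [leRHS]mulr_natl mulr2n.
have := sign_avg_expR (- l) b; rewrite sqrrN => hN.
apply: le_trans (lerD (sign_avg_expR l b) hN).
rewrite -sign_avgD; apply: sign_avg_le => e /=.
have [s0|s0] := leP 0 (sign_sum e b).
  by rewrite ger0_norm// lerDl expR_ge0.
by rewrite ltr0_norm// mulrN mulNr lerDr expR_ge0.
Qed.

(* [1 + excess b a] dominates the ratio of the sum to [a] times its standard
   deviation; the excess is summable over a family [b_k] once the [a_k] absorb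
   its size, which replaces a union bound on tails. *)
Definition excess b a e : R :=
  expR (a / 4 * (`|sign_sum e b| / Num.sqrt (\sum_i b i ^+ 2) - a)).

Lemma excess_ge0 b a e : 0 <= excess b a e.
Proof. exact: expR_ge0. Qed.

Lemma sign_sum_le_excess b a e : 2 <= a ->
  `|sign_sum e b| <= a * Num.sqrt (\sum_i b i ^+ 2) * (1 + excess b a e).
Proof.
move=> a2; rewrite /excess; set v := Num.sqrt _.
have := sqrtr_ge0 (\sum_i b i ^+ 2); rewrite -/v le_eqVlt => /predU1P[v0|v0].
  have b0 i : b i = 0.
    have /eqP : \sum_i b i ^+ 2 == 0.
      rewrite eq_le sumr_ge0 ?andbT// => [|j _]; last exact: sqr_ge0.
      by rewrite -sqrtr_eq0 -/v -v0.
    move=> /psumr_eq0P => /(_ (fun j _ => sqr_ge0 _)) /(_ i isT) /eqP.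
    by rewrite sqrf_eq0 => /eqP.
  rewrite -v0 mulr0 mul0r /sign_sum big1 ?normr0// => i _.
  by rewrite b0 mulr0.
rewrite -[leLHS](@divfK _ v) ?gt_eqF//.
set x := _ / v; rewrite [leRHS]mulrAC ler_pM2r//.
have hE := expR_ge1Dx (a / 4 * (x - a)).
have E0 := expR_gt0 (a / 4 * (x - a)).
set E := expR _ in hE E0 *.
have [xa|xa] := leP x a; first by nra.
(* Here [2 <= a] enters: as [a ^+ 2 / 4 >= 1], the linear part of the exponential, times [a], pays
   for the overshoot [x - a]. *)
have : x - a <= a * (a / 4 * (x - a)).
  have : 0 <= (a ^+ 2 - 4) * (x - a) by rewrite mulr_ge0//; nra.
  lra.
nra.
Qed.

Lemma sign_avg_excess b a : 0 <= a ->
  sign_avg (excess b a) <= 2 * expR (- (a ^+ 2 / 8)).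
Proof.
move=> a0; set s := \sum_i b i ^+ 2; set v := Num.sqrt s.
have v0 : 0 <= v by exact: sqrtr_ge0.
have s0 : 0 <= s by apply: sumr_ge0 => i _; exact: sqr_ge0.
have -> : excess b a = fun e =>
    expR (- (a ^+ 2 / 4)) * expR (a / 4 / v * `|sign_sum e b|).
  apply/funext => e; rewrite /excess -expRD; congr expR.
  rewrite -/s -/v; ring.
rewrite sign_avgZ.
(* The moment bound at [a / 4 / v] has exponent [2 * (a / 4) ^+ 2 = a ^+ 2 / 8], half of what the
   prefactor offers. *)
apply: (@le_trans _ _ (expR (- (a ^+ 2 / 4)) * (2 * expR (a ^+ 2 / 8)))).
  rewrite ler_pM2l ?expR_gt0//; apply: (le_trans (sign_avg_expR_abs _ _)).
    by rewrite !mulr_ge0 ?invr_ge0.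
  rewrite ler_pM2l ?ltr0n// ler_expR -/s.
  rewrite -(sqr_sqrtr s0) -/v.
  (* For [v = 0] the inverse is 0 by convention and the exponent vanishes. *)
  have [->|vn0] := eqVneq v 0; first by rewrite expr0n mulr0 divr_ge0 ?sqr_ge0.
  by rewrite (_ : 2 * _ * _ = a ^+ 2 / 8)//; field.
by rewrite mulrCA -expRD ler_pM2l ?ltr0n// ler_expR; lra.
Qed.

End SignSums.

(** * Chaining *)

Section EuclideanNorm.
Context {R : realType} {I : finType}.
Implicit Types (b c : I -> R).

Definition l2norm b : R := Num.sqrt (\sum_i b i ^+ 2).

Lemma l2norm_ge0 b : 0 <= l2norm b.
Proof. exact: sqrtr_ge0. Qed.

Lemma sqr_l2norm b : l2norm b ^+ 2 = \sum_i b i ^+ 2.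
Proof. by rewrite sqr_sqrtr// sumr_ge0// => i _; exact: sqr_ge0. Qed.

Lemma normr_le_l2norm b i : `|b i| <= l2norm b.
Proof.
rewrite -sqrtr_sqr ler_wsqrtr// (bigD1 i)//= lerDl sumr_ge0// => j _.
exact: sqr_ge0.
Qed.

Lemma eq_l2norm b c : (forall i, b i ^+ 2 = c i ^+ 2) -> l2norm b = l2norm c.
Proof. by move=> bc; congr Num.sqrt; exact: eq_bigr. Qed.

Lemma sum_mul_le_l2norm b c : \sum_i b i * c i <= l2norm b * l2norm c.
Proof.
have := l2norm_ge0 b; rewrite le_eqVlt => /predU1P[b0|b0].
  rewrite -b0 mul0r big1// => i _.
  have : `|b i| <= 0 by rewrite b0 normr_le_l2norm.
  by rewrite normr_le0 => /eqP ->; rewrite mul0r.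
have := l2norm_ge0 c; rewrite le_eqVlt => /predU1P[c0|c0].
  rewrite -c0 mulr0 big1// => i _.
  have : `|c i| <= 0 by rewrite c0 normr_le_l2norm.
  by rewrite normr_le0 => /eqP ->; rewrite mulr0.
set x := l2norm b in b0 *; set y := l2norm c in c0 *.
(* AM-GM, weighted so that each of the two sums equals half of [x * y]. *)
apply: (@le_trans _ _ (\sum_i (y / x / 2 * b i ^+ 2 + x / y / 2 * c i ^+ 2))).
  apply: ler_sum => i _; have := sqr_ge0 (b i / x - c i / y) => h.
  have : 0 <= x * y * (b i / x - c i / y) ^+ 2 by rewrite mulr_ge0// mulr_ge0// ltW.
  have -> : x * y * (b i / x - c i / y) ^+ 2 =
      y / x * b i ^+ 2 + x / y * c i ^+ 2 - 2 * (b i * c i).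
    by field; rewrite !gt_eqF.
  lra.
rewrite big_split/= -!mulr_sumr -!sqr_l2norm -/x -/y.
suff -> : y / x / 2 * x ^+ 2 + x / y / 2 * y ^+ 2 = x * y by [].
by field; rewrite !gt_eqF.
Qed.

Lemma l2normD b c : l2norm (b \+ c) <= l2norm b + l2norm c.
Proof.
rewrite -(@ler_pXn2r _ 2)// ?nnegrE ?addr_ge0 ?l2norm_ge0//.
rewrite sqr_l2norm sqrrD !sqr_l2norm.
have -> : \sum_i (b \+ c) i ^+ 2 =
    \sum_i b i ^+ 2 + (\sum_i b i * c i) *+ 2 + \sum_i c i ^+ 2.
  rewrite -sumrMnl -!big_split/=; apply: eq_bigr => i _; exact: sqrrD.
rewrite lerD2r lerD2l lerMn2r/=; exact: sum_mul_le_l2norm.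
Qed.

End EuclideanNorm.

(** The crude factor [n] is paid only on the last link of a chain, whose length will be of order
    [1 / n]. *)
Lemma sign_sum_le_l2norm {R : realType} {n : nat} e (b : 'I_n -> R) :
  `|sign_sum e b| <= n%:R * l2norm b.
Proof.
apply: le_trans (ler_norm_sum _ _ _) _.
apply: (@le_trans _ _ (\sum_(i < n) l2norm b)).
  by apply: ler_sum => i _; rewrite normrM normr_sign mul1r normr_le_l2norm.
by rewrite sumr_const card_ord mulr_natl.
Qed.

Lemma sign_sumB {R : realType} {n : nat} e (b c : 'I_n -> R) :
  sign_sum e (b \- c) = sign_sum e b - sign_sum e c.
Proof.
by rewrite /sign_sum -sumrB; apply: eq_bigr => i _; rewrite -mulrBr.
Qed.

Section Chaining.
Context {R : realType} {n : nat} {T : choiceType}.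
Variables (f : T -> 'I_n -> R) (A : set T) (t0 : T) (At0 : A t0).
Variables (code : nat -> T -> nat) (N : nat -> nat).
Hypothesis code_lt : forall s t, A t -> (code s t < N s)%N.
Hypothesis N0 : N 0%N = 1%N.
Variable Delta : nat -> T -> R.
Hypothesis code_diam : forall s t u, A t -> A u -> code s t = code s u ->
  l2norm (f t \- f u) <= Delta s t.
Variables (a : nat -> R) (a_ge2 : forall s, 2 <= a s) (S : nat).

(** One point per cell, depending on the cell alone, so that the links between two consecutive
    levels form a finite family. An empty cell gets [t0]. *)
Let rep s c := xget t0 [set u | A u /\ code s u = c].

Let rep_code s t : A t ->
  A (rep s (code s t)) /\ code s (rep s (code s t)) = code s t.
Proof.
by move=> At; rewrite /rep; case: xgetP => [u -> //|/(_ t)[]].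
Qed.

Let rep_diam s t : A t -> l2norm (f t \- f (rep s (code s t))) <= Delta s t.
Proof. by move=> At; have [? ?] := rep_code s At; exact: code_diam. Qed.

(** A single random factor that dominates every link at once, at the cost of summing over all pairs
    of cells of consecutive levels. *)
Let U e := 1 + \sum_(s < S) \sum_(c < N s) \sum_(c' < N s.+1)
  excess (f (rep s c) \- f (rep s.+1 c')) (a s) e.

Let U_ge s c c' e : (s < S)%N -> (c < N s)%N -> (c' < N s.+1)%N ->
  1 + excess (f (rep s c) \- f (rep s.+1 c')) (a s) e <= U e.
Proof.
move=> sS cN c'N; rewrite /U lerD2l.
rewrite (bigD1 (Ordinal sS))//= (bigD1 (Ordinal cN))//= (bigD1 (Ordinal c'N))//=.
rewrite -!addrA lerDl !addr_ge0// !sumr_ge0// => i _; rewrite ?excess_ge0//.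
  by rewrite sumr_ge0// => j _; rewrite excess_ge0.
by rewrite !sumr_ge0// => j _; rewrite sumr_ge0// => k _; rewrite excess_ge0.
Qed.

Let U_ge1 e : 1 <= U e.
Proof.
rewrite lerDl sumr_ge0// => i _; rewrite sumr_ge0// => j _.
by rewrite sumr_ge0// => k _; rewrite excess_ge0.
Qed.

Let U_avg : sign_avg U <=
  1 + 2 * \sum_(s < S) (N s * N s.+1)%:R * expR (- (a s ^+ 2 / 8)).
Proof.
rewrite sign_avgD sign_avg_cst lerD2l sign_avg_sum mulr_sumr.
apply: ler_sum => s _; rewrite sign_avg_sum.
under eq_bigr do rewrite sign_avg_sum.
apply: (@le_trans _ _ (\sum_(c < N s) \sum_(c' < N s.+1)
    (2 * expR (- (a s ^+ 2 / 8))))).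
  apply: ler_sum => c _; apply: ler_sum => c' _.
  by rewrite sign_avg_excess// (le_trans _ (a_ge2 s)).
rewrite !sumr_const !card_ord -mulrnA -[_ *+ _]mulr_natl mulnC.
by rewrite mulrCA.
Qed.

(** The increments telescope along the representatives of the cells of [t], and the last link is
    bounded deterministically by [H]. As [Delta s] depends on the point, [G] bounds a sum along each
    path rather than the sum of the largest diameters; this is the gain over an entropy integral.
    The factor 2 comes from comparing both [t] and [t0] with the root. *)
Lemma chaining (G H : R) :
    (forall t, A t -> \sum_(s < S) a s * (Delta s t + Delta s.+1 t) <= G) ->
    (forall t, A t -> n%:R * Delta S t <= H) ->
  exists V : {ffun 'I_n -> bool} -> R,
    sign_avg V <=
      1 + 2 * \sum_(s < S) (N s * N s.+1)%:R * expR (- (a s ^+ 2 / 8)) /\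
    forall e t, A t -> `|sign_sum e (f t \- f t0)| <= 2 * (G * V e + H).
Proof.
move=> GE HE; exists U; split=> // e.
suff root t : A t ->
    `|sign_sum e (f t) - sign_sum e (f (rep 0%N 0%N))| <= G * U e + H.
  move=> t At; have := root t At; have := root t0 At0.
  set x := sign_sum e (f t); set y := sign_sum e (f t0).
  rewrite (distrC y) sign_sumB -/x -/y; set r := sign_sum e _ => h1 h2.
  by rewrite (le_trans (ler_distD r _ _))//; lra.
move=> At; set x := fun s => sign_sum e (f (rep s (code s t))).
(* Level 0 has a single cell, so all chains start at the same representative. *)
have code0 : code 0%N t = 0%N.
  by have := code_lt 0 At; rewrite N0 ltnS leqn0 => /eqP.
rewrite -[X in rep _ X]code0 -/(x 0%N).
have link s : (s < S)%N ->
    `|x s.+1 - x s| <= a s * (Delta s t + Delta s.+1 t) * U e.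
  move=> sS; rewrite distrC /x -sign_sumB.
  apply: le_trans (sign_sum_le_excess _ _ (a_ge2 s)) _.
  rewrite -/(l2norm _) -!mulrA ler_pM2l; last exact: lt_le_trans (a_ge2 s).
  apply: ler_pM; rewrite ?l2norm_ge0 ?addr_ge0 ?excess_ge0//.
    set g := _ \- _.
    have -> : g = (fun i => - (f t \- f (rep s (code s t))) i) \+
        (f t \- f (rep s.+1 (code s.+1 t))).
      by apply/funext => i; rewrite /g /=; ring.
    apply: le_trans (l2normD _ _) _; apply: lerD; last exact: rep_diam.
    by rewrite (@eq_l2norm _ _ _ (f t \- f (rep s (code s t)))) ?rep_diam// => i;
      rewrite sqrrN.
  by apply: U_ge => //; exact: code_lt.
have tele s : (s <= S)%N ->
    `|x s - x 0%N| <= (\sum_(k < s) a k * (Delta k t + Delta k.+1 t)) * U e.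
  elim: s => [|s IH] sS; first by rewrite subrr normr0 big_ord0 mul0r.
  rewrite big_ord_recr/= mulrDl.
  rewrite (le_trans (ler_distD (x s) _ _))// addrC lerD//; first exact/IH/ltnW.
  exact: link.
apply: (@le_trans _ _ (`|x S - x 0%N| + `|sign_sum e (f t) - x S|)).
  by rewrite [leRHS]addrC ler_distD.
apply: lerD.
  by rewrite (le_trans (tele _ (leqnn _)))// ler_wpM2r ?GE// (le_trans _ (U_ge1 e)).
rewrite -sign_sumB (le_trans (sign_sum_le_l2norm _ _))// (le_trans _ (HE _ At))//.
by rewrite ler_wpM2l// rep_diam.
Qed.

End Chaining.

(** * Cells of the l1-ball *)

Section TailSum.
Context {R : realType}.
Variables (a : nat -> R) (S : nat).
Hypothesis a_ge0 : forall k, 0 <= a k.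
Hypothesis a_dec : forall k l, (k <= l)%N -> a l <= a k.
Hypothesis a_sum : \sum_(0 <= k < 4 ^ S) a k <= 1.

Let tl s := Num.sqrt (\sum_(4 ^ s <= k < 4 ^ S) a k ^+ 2).

(** The block has [3 * 4 ^ s] terms, each at most [a (4 ^ s)], so its squares sum to at most the
    square of [2 * 2 ^ s * a (4 ^ s)]. *)
Let tlS s : (s < S)%N -> tl s <= 2 * (2 ^+ s * a (4 ^ s)%N) + tl s.+1.
Proof.
move=> sS.
have t0 : 0 <= \sum_(4 ^ s.+1 <= k < 4 ^ S) a k ^+ 2.
  by apply: sumr_ge0 => k _; exact: sqr_ge0.
have h0 : 0 <= 2 * (2 ^+ s * a (4 ^ s)%N) by rewrite !mulr_ge0 ?exprn_ge0.
rewrite -(@ler_pXn2r _ 2)// ?nnegrE ?addr_ge0 ?sqrtr_ge0//.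
rewrite sqrrD !sqr_sqrtr//; last by apply: sumr_ge0 => k _; exact: sqr_ge0.
rewrite (@big_cat_nat _ _ _ (4 ^ s.+1))/=; last 2 first.
- by rewrite leq_exp2l.
- by rewrite leq_exp2l.
rewrite lerD2r.
apply: (@le_trans _ _ (\sum_(4 ^ s <= k < 4 ^ s.+1) a (4 ^ s)%N ^+ 2)).
  apply: ler_sum_nat => k /andP[k1 _].
  by rewrite ler_pXn2r// ?nnegrE// a_dec.
rewrite sumr_const_nat -[_ *+ _]mulr_natl.
have -> : (4 ^ s.+1 - 4 ^ s = 3 * 4 ^ s)%N by rewrite expnS; lia.
have -> : (2 * (2 ^+ s * a (4 ^ s)%N)) ^+ 2 = 4 * ((4 ^ s)%:R * a (4 ^ s)%N ^+ 2) :> R.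
  rewrite !exprMn -exprM mulnC exprM natrX; congr (_ * (_ ^+ s * _)); lra.
rewrite natrM -mulrA.
have : 0 <= (4 ^ s)%:R * a (4 ^ s)%N ^+ 2 by rewrite mulr_ge0// sqr_ge0.
have : 0 <= 2 * (2 ^+ s * a (4 ^ s)%N) * tl s.+1 by rewrite mulr_ge0 ?sqrtr_ge0.
rewrite -[_ *+ 2]mulr_natl -/(tl s.+1).
lra.
Qed.

Let head_sum_le1 s : (s <= S)%N -> \sum_(0 <= k < 4 ^ s) a k <= 1.
Proof.
move=> sS; apply: le_trans a_sum.
by rewrite [leRHS](@big_cat_nat _ _ _ (4 ^ s))/= ?leq_exp2l// lerDl sumr_ge0.
Qed.

(** The block just below [4 ^ k] has [3 * 4 ^ k.-1] terms that are no smaller than [a (4 ^ k)],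
    whence the factor [4 / 3], rounded up to 2, and the end at [4 ^ s.-1]. For [k = 0] there is no
    such block, and [a 0] pays. *)
Let dyadic_sum s : (s <= S)%N ->
  \sum_(k < s) 4 ^+ k * a (4 ^ k)%N <= a 0%N + 2 * \sum_(0 <= k < 4 ^ s.-1) a k.
Proof.
elim: s => [|s IH] sS.
  by rewrite big_ord0 addr_ge0 ?mulr_ge0 ?sumr_ge0.
rewrite big_ord_recr/=.
case: s => [|s] in IH sS *.
  rewrite big_ord0 add0r expr0 mul1r expn0 big_nat1.
  by have := a_dec (leqnSn 0); have := a_ge0 0; lra.
rewrite (@big_cat_nat _ _ _ (4 ^ s))/= ?leq_exp2l// mulrDr addrA.
rewrite lerD ?IH ?(ltnW sS)//.
apply: (@le_trans _ _ (2 * \sum_(4 ^ s <= k < 4 ^ s.+1) a (4 ^ s.+1)%N)).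
  rewrite sumr_const_nat -[a _ *+ _]mulr_natl.
  have -> : (4 ^ s.+1 - 4 ^ s = 3 * 4 ^ s)%N by rewrite expnS; lia.
  rewrite natrM natrX exprS.
  have : 0 <= 4 ^+ s * a (4 ^ s.+1)%N by rewrite mulr_ge0 ?exprn_ge0.
  lra.
rewrite ler_pM2l//; apply: ler_sum_nat => k /andP[_ k1].
by rewrite a_dec// ltnW.
Qed.

(* With [x s := 2 ^+ s * tl s] and [y s := 4 ^+ s * a (4 ^ s)], the block
   [4^s, 4^(s+1)) gives [x s <= 2 y s + x s.+1 / 2], and [\sum y] is at most
   twice the total sum plus [a 0] since [a] is nonincreasing. *)
Lemma sum_l2tails : \sum_(s < S) 2 ^+ s * tl s <= 12.
Proof.
have tlS0 : tl S = 0 by rewrite /tl big_geq ?sqrtr0.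
have rec s : (s <= S)%N -> \sum_(k < s) 2 ^+ k * tl k <=
    4 * \sum_(k < s) 4 ^+ k * a (4 ^ k)%N + 2 ^+ s * tl s.
  have tl_ge0 k : 0 <= 2 ^+ k * tl k by rewrite mulr_ge0 ?exprn_ge0 ?sqrtr_ge0.
  (* Since [2 * x s <= 4 * y s + x s.+1], the remainder keeps the coefficient 1. *)
  elim: s => [|s IH] sS; first by rewrite !big_ord0 mulr0 add0r.
  rewrite !big_ord_recr/= mulrDr.
  have h := IH (ltnW sS).
  have : 2 ^+ s * tl s <= 2 ^+ s * (2 * (2 ^+ s * a (4 ^ s)%N) + tl s.+1).
    by rewrite ler_pM2l ?exprn_gt0// tlS.
  have -> : 2 ^+ s * (2 * (2 ^+ s * a (4 ^ s)%N) + tl s.+1) =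
      2 * (4 ^+ s * a (4 ^ s)%N) + 2 ^+ s * tl s.+1.
    have -> : (4 : R) = 2 * 2 by lra.
    by rewrite exprMn; ring.
  rewrite exprS; lra.
(* The constant is [12 = 4 * (1 + 2 * 1)], from [a 0 <= 1] and a total of at most 1. *)
have := rec S (leqnn _); rewrite tlS0 mulr0 addr0 => h1.
have h2 := dyadic_sum (leqnn S).
have h3 := head_sum_le1 (leq_pred S).
have h4 : a 0%N <= 1.
  apply: le_trans (head_sum_le1 (leq0n S)).
  by rewrite expn0 big_nat1.
lra.
Qed.

End TailSum.

Section L1BallCode.
Context {R : realType} {p : nat}.
Variable j0 : 'I_p.
Implicit Types (t u : 'rV[R]_p) (s : nat).

Definition by_magnitude t : seq 'I_p :=
  sort (fun i j => `|t 0 j| <= `|t 0 i|) (enum 'I_p).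

Lemma size_by_magnitude t : size (by_magnitude t) = p.
Proof. by rewrite size_sort size_enum_ord. Qed.

Lemma perm_by_magnitude t u : perm_eq (by_magnitude t) (by_magnitude u).
Proof.
by rewrite perm_sort perm_sym perm_sort.
Qed.

Lemma sum_by_magnitude t (F : 'I_p -> R) :
  \sum_j F j = \sum_(j <- by_magnitude t) F j.
Proof.
rewrite [RHS](perm_big (enum 'I_p)) ?big_enum//=.
by rewrite /by_magnitude perm_sort.
Qed.

Definition l2tail s t : R :=
  Num.sqrt (\sum_(j <- drop (4 ^ s) (by_magnitude t)) t 0 j ^+ 2).

(** The nonincreasing rearrangement of the absolute values, padded by 0 beyond [p] so that sums may
    run up to a power of 4. *)
Definition magnitude t k : R := nth 0 [seq `|t 0 j| | j <- by_magnitude t] k.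

Lemma magnitude_ge0 t k : 0 <= magnitude t k.
Proof.
rewrite /magnitude; have [kp|kp] := ltnP k p.
  by rewrite (nth_map j0) ?size_by_magnitude.
by rewrite nth_default// size_map size_by_magnitude.
Qed.

Lemma magnitude_dec t k l : (k <= l)%N -> magnitude t l <= magnitude t k.
Proof.
move=> kl; have [lp|lp] := ltnP l p; last first.
  by rewrite {1}/magnitude nth_default ?magnitude_ge0// size_map size_by_magnitude.
have kp := leq_ltn_trans kl lp.
rewrite /magnitude !(nth_map j0) ?size_by_magnitude//.
pose r := fun i j => `|t 0 j| <= `|t 0 i|.
apply: (@sorted_leq_nth _ r); rewrite ?inE ?size_by_magnitude//.
- by move=> i j k'; rewrite /r => h1 h2; exact: le_trans h2 h1.
- by move=> i; rewrite /r.
- by apply: sort_sorted => i j; rewrite /r le_total.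
Qed.

Lemma sum_drop_magnitude t (F : R -> R) m P : F 0 = 0 -> (p <= P)%N ->
  (forall x, F `|x| = F x) ->
  \sum_(j <- drop m (by_magnitude t)) F (t 0 j) =
  \sum_(m <= k < P) F (magnitude t k).
Proof.
move=> F0 pP Fabs.
under eq_bigr do rewrite -Fabs.
rewrite -(big_map (fun j => `|t 0 j|) predT F)/= map_drop.
set l := map _ _.
have sl : size l = p by rewrite size_map size_by_magnitude.
rewrite (big_nth 0) size_drop sl.
have [mp|pm] := leqP m p; last first.
  have -> : (p - m)%N = 0%N by apply/eqP; rewrite subn_eq0 ltnW.
  rewrite [LHS]big_geq//; apply/esym.
  rewrite big_nat_cond big1// => k /andP[/andP[mk _] _].
  by rewrite /magnitude nth_default// -/l sl (leq_trans _ mk)// ltnW.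
rewrite [RHS](@big_cat_nat _ _ _ p)//= [X in _ + X]big_nat_cond.
rewrite [X in _ + X]big1 ?addr0; last first.
  by move=> k /andP[/andP[mk _] _]; rewrite /magnitude nth_default// -/l sl.
rewrite -[in RHS](add0n m) big_addn; apply: eq_bigr => k _.
by rewrite nth_drop addnC.
Qed.

Lemma l2tailE s t P : (p <= P)%N ->
  l2tail s t = Num.sqrt (\sum_(4 ^ s <= k < P) magnitude t k ^+ 2).
Proof.
move=> pP; congr Num.sqrt.
apply: (sum_drop_magnitude _ _ (F := fun x => x ^+ 2)) => //.
- by rewrite expr0n.
- by move=> x; rewrite real_normK// num_real.
Qed.

Lemma sum_l2tail S t : (p <= 4 ^ S)%N -> l1norm t <= 1 ->
  \sum_(s < S) 2 ^+ s * l2tail s t <= 12.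
Proof.
move=> pS t1.
under eq_bigr do rewrite (@l2tailE _ _ _ pS).
apply: (@sum_l2tails _ (magnitude t)).
- exact: magnitude_ge0.
- by move=> k l; exact: magnitude_dec.
- rewrite (eq_bigr (fun k => `|magnitude t k|)); last first.
    by move=> k _; rewrite ger0_norm ?magnitude_ge0.
  have := @sum_drop_magnitude t Num.norm 0 _ (normr0 _) pS (@normr_id _ _).
  by rewrite drop0 -sum_by_magnitude => <-.
Qed.

Lemma l2tail_eq0 S t : (p <= 4 ^ S)%N -> l2tail S t = 0.
Proof.
by move=> pS; rewrite /l2tail drop_oversize ?big_nil ?sqrtr0// size_by_magnitude.
Qed.

(** [inord] is faithful only if the integer part is at most [K], hence the range conditions in
    [quantize_eq]. *)
Definition quantize K (x : R) : 'I_K.+1 := inord (Num.truncn x).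

Lemma quantize_eq K x y : 0 <= x <= K%:R -> 0 <= y <= K%:R ->
  quantize K x = quantize K y -> `|x - y| <= 1.
Proof.
move=> /andP[x0 xK] /andP[y0 yK] /(congr1 val) /=.
have h (z : R) : 0 <= z -> z <= K%:R -> (Num.truncn z < K.+1)%N.
  move=> z0 zK; rewrite ltnS -(ler_nat R); apply: le_trans zK.
  by case/andP: (truncn_itv z0).
rewrite !inordK ?h// => xy.
have /andP[x1 x2] := truncn_itv x0; have /andP[y1 y2] := truncn_itv y0.
rewrite xy -natr1 in x1 x2; rewrite -natr1 in y2.
by rewrite ler_norml; lra.
Qed.

(** Values are rounded to multiples of [8 ^- s]: over [4 ^ s] coordinates this makes an l2-error of
    [2 ^ s * 8 ^- s = 4 ^- s]. Coordinates lie in [-1, 1] and are shifted to [0, 2], hence the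
    larger range. *)
Definition cell_type s : finType :=
  ({ffun 'I_(minn (4 ^ s) p) -> 'I_p * 'I_(2 * 8 ^ s).+1} * 'I_(8 ^ s).+1)%type.

(* Recording the rounded tail norm makes all points of a cell have comparable
   tails, so the tail of any one of them controls the diameter of the cell. *)
Definition cell s t : cell_type s :=
  ([ffun k : 'I__ => let j := nth j0 (by_magnitude t) k in
      (j, quantize (2 * 8 ^ s) (8 ^+ s * (1 + t 0 j)))],
   quantize (8 ^ s) (8 ^+ s * l2tail s t)).

Lemma normr_le_l1norm t j : `|t 0 j| <= l1norm t.
Proof. by rewrite /l1norm (bigD1 j)//= lerDl sumr_ge0. Qed.

Lemma l2norm_le_l1norm t : l2norm (t 0) <= l1norm t.
Proof.
rewrite -(@ler_pXn2r _ 2)// ?nnegrE ?l2norm_ge0 ?sumr_ge0//.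
rewrite sqr_l2norm expr2 {1}/l1norm mulr_suml; apply: ler_sum => j _.
by rewrite -real_normK ?num_real// expr2 ler_wpM2l// normr_le_l1norm.
Qed.

Lemma l2tail_le1 s t : l1norm t <= 1 -> 0 <= l2tail s t <= 1.
Proof.
move=> t1; rewrite sqrtr_ge0/=.
apply: le_trans t1; apply: le_trans (l2norm_le_l1norm t); apply: ler_wsqrtr.
rewrite (sum_by_magnitude t) -{2}(cat_take_drop (4 ^ s) (by_magnitude t)).
by rewrite big_cat/= lerDr sumr_ge0// => j _; exact: sqr_ge0.
Qed.

Lemma cell_diam s t u : l1norm t <= 1 -> l1norm u <= 1 ->
  cell s t = cell s u ->
  l2norm (t 0 \- u 0) <= 2 * l2tail s t + 2 / 4 ^+ s.
Proof.
move=> t1 u1 tu.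
have s8 : (0 : R) < 8 ^+ s by rewrite exprn_gt0.
have s4 : (0 : R) < 4 ^+ s by rewrite exprn_gt0.
have tail_tu : l2tail s u <= l2tail s t + (8 ^+ s)^-1.
  have : `|8 ^+ s * l2tail s t - 8 ^+ s * l2tail s u| <= 1.
    have h (v : 'rV[R]_p) : l1norm v <= 1 -> 0 <= 8 ^+ s * l2tail s v <= (8 ^ s)%:R.
      move=> /(l2tail_le1 s)/andP[v0 v1].
      by rewrite natrX mulr_ge0 ?(ltW s8)//= -[leRHS]mulr1 ler_pM2l.
    by apply: (@quantize_eq (8 ^ s)); rewrite ?h//; case: tu.
  rewrite -mulrBr normrM (gtr0_norm s8) mulrC -ler_pdivlMr// div1r.
  by rewrite ler_norml => /andP[]; lra.
have coord k : (k < minn (4 ^ s) p)%N ->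
    let j := nth j0 (by_magnitude t) k in
    j = nth j0 (by_magnitude u) k /\ `|t 0 j - u 0 j| <= (8 ^+ s)^-1.
  move=> km j; case: tu => /ffunP/(_ (Ordinal km)); rewrite !ffunE/= => -[jE qE] _.
  rewrite /j; split=> //; rewrite -{}jE -/j in qE.
  have : `|8 ^+ s * (1 + t 0 j) - 8 ^+ s * (1 + u 0 j)| <= 1.
    have h (v : 'rV[R]_p) : l1norm v <= 1 -> 0 <= 8 ^+ s * (1 + v 0 j) <= (2 * 8 ^ s)%:R.
      move=> v1; have := le_trans (normr_le_l1norm v j) v1.
      rewrite ler_norml => /andP[v2 v3]; rewrite mulr_ge0 ?(ltW s8)//=; last lra.
      by rewrite natrM natrX mulrC ler_pM2r//; lra.
    by apply: (@quantize_eq (2 * 8 ^ s)); rewrite ?h.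
  rewrite -mulrBr normrM (gtr0_norm s8) mulrC -ler_pdivlMr// div1r.
  by rewrite opprD addrACA subrr add0r.
(* Equal cells list the same leading indices in the same order, so the remaining indices agree up to
   a permutation. *)
have take_tu : take (4 ^ s) (by_magnitude t) = take (4 ^ s) (by_magnitude u).
  apply: (@eq_from_nth _ j0); first by rewrite !size_take !size_by_magnitude.
  move=> k; rewrite size_take size_by_magnitude => km.
  have {}km : (k < minn (4 ^ s) p)%N by rewrite /minn.
  have := km; rewrite leq_min => /andP[k4 _].
  by rewrite !nth_take//; have [] := coord _ km.
have drop_tu : perm_eq (drop (4 ^ s) (by_magnitude t)) (drop (4 ^ s) (by_magnitude u)).
  have := perm_by_magnitude t u.
  rewrite -{1}(cat_take_drop (4 ^ s) (by_magnitude t)).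
  by rewrite -{1}(cat_take_drop (4 ^ s) (by_magnitude u)) take_tu perm_cat2l.
have tail0 (v : 'rV[R]_p) : 0 <= \sum_(j <- drop (4 ^ s) (by_magnitude v)) v 0 j ^+ 2.
  by rewrite sumr_ge0// => j _; exact: sqr_ge0.
have tailt := sqr_sqrtr (tail0 t); rewrite -/(l2tail s t) in tailt.
have tailu := sqr_sqrtr (tail0 u); rewrite -/(l2tail s u) in tailu.
have Lt : 0 <= l2tail s t by exact: sqrtr_ge0.
have Lu : 0 <= l2tail s u by exact: sqrtr_ge0.
have s8V : (0 : R) < (8 ^+ s)^-1 by rewrite invr_gt0.
have s4V : (0 : R) < (4 ^+ s)^-1 by rewrite invr_gt0.
rewrite -(@ler_pXn2r _ 2)// ?nnegrE ?l2norm_ge0 ?addr_ge0 ?mulr_ge0 ?(ltW s4V)//.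
rewrite sqr_l2norm (sum_by_magnitude t).
rewrite -{1}(cat_take_drop (4 ^ s) (by_magnitude t)) big_cat/=.
have head : \sum_(j <- take (4 ^ s) (by_magnitude t)) (t 0 j - u 0 j) ^+ 2 <=
    ((4 ^+ s)^-1) ^+ 2.
  apply: (@le_trans _ _ (\sum_(j <- take (4 ^ s) (by_magnitude t)) ((8 ^+ s)^-1) ^+ 2)).
    rewrite big_seq [leRHS]big_seq; apply: ler_sum => j /(nthP j0)[k].
    rewrite size_take size_by_magnitude => km <-.
    have {}km : (k < minn (4 ^ s) p)%N by rewrite /minn.
    have := km; rewrite leq_min => /andP[k4 _]; rewrite nth_take//.
    have [_ h] := coord _ km.
    by rewrite -real_normK ?num_real// ler_pXn2r// ?nnegrE ?(ltW s8V).
  rewrite big_const_seq count_predT iter_addr_0 size_take_min.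
  rewrite -[_ *+ _]mulr_natl.
  apply: (@le_trans _ _ (4 ^+ s * (8 ^+ s)^-1 ^+ 2)).
    rewrite ler_wpM2r ?sqr_ge0// -natrX ler_nat; exact: geq_minl.
  rewrite -!exprVn -!exprM mulnC !exprM -exprMn lerXn2r ?nnegrE//; lra.
(* No coordinate is recorded here, so both tail norms enter; [tail_tu] then trades the one of [u]
   for that of [t]. *)
have tail : \sum_(j <- drop (4 ^ s) (by_magnitude t)) (t 0 j - u 0 j) ^+ 2 <=
    2 * l2tail s t ^+ 2 + 2 * l2tail s u ^+ 2.
  rewrite tailt tailu -(perm_big _ drop_tu)/= !mulr_sumr -big_split/=.
  by apply: ler_sum => j _; have := sqr_ge0 (t 0 j + u 0 j); lra.
have V84 : (8 ^+ s)^-1 <= (4 ^+ s)^-1 :> R.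
  by rewrite lef_pV2 ?posrE// lerXn2r ?nnegrE//; lra.
apply: (le_trans (lerD head tail)).
move: (l2tail s t) (l2tail s u) ((8 ^+ s)^-1) ((4 ^+ s)^-1) Lt Lu tail_tu V84 s8V s4V.
clear => x y q r x0 y0 yx qr q0 r0.
have : y ^+ 2 <= (x + r) ^+ 2 by rewrite ler_pXn2r ?nnegrE//; lra.
have : 0 <= x * r by rewrite mulr_ge0// ltW.
have := sqr_ge0 r.
lra.
Qed.

(** Rounding costs about [s] nats per recorded coordinate; this keeps the factor [s] out of the
    entropy. Either [2 ^ s <= 2 * p], or at most [p < 2 ^ s] coordinates are recorded and
    [s * p <= 4 ^ s]. *)
Lemma pow2_min_le s : ((2 ^ s) ^ minn (4 ^ s) p <= (2 * p) ^ 4 ^ s)%N.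
Proof.
have p0 : (0 < p)%N by exact: leq_ltn_trans (ltn_ord j0).
have [le|lt] := leqP (2 ^ s) (2 * p).
  apply: (@leq_trans ((2 * p) ^ minn (4 ^ s) p)); first by rewrite leq_exp2r// leq_min expn_gt0.
  by rewrite leq_pexp2l ?geq_minl// muln_gt0.
apply: (@leq_trans (2 ^ 4 ^ s)); last first.
  by rewrite leq_exp2r ?expn_gt0// leq_pmulr.
rewrite -expnM leq_exp2l//.
have s2 : (s < 2 ^ s)%N by exact: ltn_expl.
have -> : (4 ^ s = 2 ^ s * 2 ^ s)%N by rewrite -expnMn.
have := geq_minr (4 ^ s) p; nia.
Qed.

Lemma card_cell_type_le s : (#|cell_type s| <= (2 * p) ^ (10 * 4 ^ s))%N.
Proof.
have p0 : (0 < p)%N by exact: leq_ltn_trans (ltn_ord j0).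
rewrite /cell_type card_prod card_ffun card_prod !card_ord.
set m := minn _ _; have m0 : (0 < m)%N by rewrite /m leq_min expn_gt0.
have e8 : (8 ^ s = (2 ^ s) ^ 3)%N by rewrite -expnM mulnC expnM.
have e80 : (0 < 8 ^ s)%N by rewrite expn_gt0.
apply: (@leq_trans ((4 * p * 8 ^ s) ^ m * (4 * p * 8 ^ s) ^ m)).
  apply: leq_mul; first by rewrite leq_exp2r//; nia.
  apply: (@leq_trans ((4 * p * 8 ^ s) ^ 1)); first by rewrite expn1; nia.
  by rewrite leq_pexp2l//; nia.
rewrite -expnD addnn -muln2 expnMn.
have hm : (m <= 4 ^ s)%N by exact: geq_minl.
(* The exponent 10 is 4 + 6: [4 * p] is at most the square of [2 * p], and [8 ^ s] is the cube of
   [2 ^ s], both raised to the power [2 * m]. *)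
have -> : (10 * 4 ^ s = 2 * (2 * 4 ^ s) + 4 ^ s * 6)%N by lia.
rewrite expnD; apply: leq_mul.
  rewrite [leqRHS]expnM; apply: (@leq_trans (((2 * p) ^ 2) ^ (m * 2))).
    rewrite leq_exp2r ?muln_gt0 ?m0//; nia.
  by rewrite leq_pexp2l//; nia.
rewrite e8 -expnM.
have -> : (3 * (m * 2) = m * 6)%N by lia.
by rewrite expnM [leqRHS]expnM leq_exp2r// pow2_min_le.
Qed.

(** Level [s.+1] uses the cells of level [s], which makes room for the single cell at level 0
    required by [chaining]. *)
Definition l1code s t : nat :=
  if s is s'.+1 then enum_rank (cell s' t) else 0%N.

Definition l1codes s : nat := if s is s'.+1 then #|cell_type s'| else 1%N.

Definition l1diam s t : R :=
  if s is s'.+1 then 2 * l2tail s' t + 2 / 4 ^+ s' else 2.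

Lemma l1code_lt s t : (l1code s t < l1codes s)%N.
Proof. by case: s => //= s; exact: ltn_ord. Qed.

Lemma l1code_diam s t u : l1norm t <= 1 -> l1norm u <= 1 ->
  l1code s t = l1code s u -> l2norm (t 0 \- u 0) <= l1diam s t.
Proof.
move=> t1 u1; case: s => [_|s] /=; last first.
  by move=> /ord_inj/enum_rank_inj; exact: cell_diam.
have -> : t 0 \- u 0 = t 0 \+ (fun j => - u 0 j) by [].
apply: le_trans (l2normD _ _) _.
rewrite (@eq_l2norm _ _ (fun j => - u 0 j) (u 0)); last by move=> i; rewrite sqrrN.
have := le_trans (l2norm_le_l1norm t) t1.
have := le_trans (l2norm_le_l1norm u) u1; lra.
Qed.

Lemma geometric_sum_le2 S : \sum_(s < S) 2^-1 ^+ s <= 2 :> R.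
Proof.
suff : \sum_(s < S) 2^-1 ^+ s <= 2 - 2 * 2^-1 ^+ S :> R.
  by have : 0 <= 2^-1 ^+ S :> R; [rewrite exprn_ge0|lra].
elim: S => [|S IH]; first by rewrite big_ord0 expr0; lra.
by rewrite big_ord_recr/= exprS; lra.
Qed.

Lemma sum_l1diam S t : (p <= 4 ^ S)%N -> l1norm t <= 1 ->
  \sum_(s < S.+1) 2 ^+ s * (l1diam s t + l1diam s.+1 t) <= 100.
Proof.
move=> pS t1.
have half s : 2 ^+ s * (2 / 4 ^+ s) = 2 * 2^-1 ^+ s :> R.
  have -> : (4 : R) = 2 * 2 by lra.
  by rewrite exprMn exprVn; field; rewrite expf_neq0.
have diamE s : 2 ^+ s * l1diam s.+1 t =
    2 * (2 ^+ s * l2tail s t) + 2 * 2^-1 ^+ s.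
  by rewrite /= mulrDr half; ring.
have sum1 m : \sum_(s < m) 2 ^+ s * l1diam s.+1 t =
    2 * (\sum_(s < m) 2 ^+ s * l2tail s t) + 2 * \sum_(s < m) 2^-1 ^+ s.
  by rewrite !mulr_sumr -big_split; apply: eq_bigr => s _; exact: diamE.
have sum0 : \sum_(s < S.+1) 2 ^+ s * l1diam s t =
    2 + 2 * \sum_(s < S) 2 ^+ s * l1diam s.+1 t.
  rewrite big_ord_recl expr0 mul1r mulr_sumr; congr (_ + _).
  by apply: eq_bigr => s _; rewrite lift0 exprS -mulrA.
under eq_bigr do rewrite mulrDr.
rewrite [leLHS](_ : _ = \sum_(s < S.+1) 2 ^+ s * l1diam s t +
    \sum_(s < S.+1) 2 ^+ s * l1diam s.+1 t); last exact: big_split.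
rewrite sum0 !sum1.
(* The tail at level [S] is zero, so both sums of tails are at most 12; with [28 = 2 * 12 + 2 * 2]
   the total is [2 + 2 * 28 + 28 = 86]. *)
rewrite [X in _ + (2 * X + _)]big_ord_recr [l2tail S t]l2tail_eq0// mulr0.
have := sum_l2tail pS t1; have := geometric_sum_le2 S.
have := geometric_sum_le2 S.+1; rewrite big_ord_recr/=.
have : 0 <= \sum_(s < S) 2^-1 ^+ s :> R by rewrite sumr_ge0.
lra.
Qed.

Lemma l1codes_mul s :
  (l1codes s * l1codes s.+1 <= (2 * p) ^ (20 * 4 ^ s))%N.
Proof.
have p0 : (0 < p)%N by exact: leq_ltn_trans (ltn_ord j0).
have pw : (0 < 2 * p)%N by rewrite muln_gt0.
case: s => [|s]; rewrite [l1codes _.+1]/=.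
  rewrite mul1n (leq_trans (card_cell_type_le 0))// leq_pexp2l//.
(* The shift of levels leaves room: [10 * 4 ^ s + 10 * 4 ^ s.+1 = 50 * 4 ^ s] is below
   [20 * 4 ^ s.+1]. *)
apply: leq_trans (leq_mul (card_cell_type_le s) (card_cell_type_le s.+1)) _.
by rewrite -expnD leq_pexp2l// expnS; lia.
Qed.

End L1BallCode.

(** * Chaining applied to the l1-ball *)

Section L1BallProcess.
Context {R : realType} {n p : nat}.
Hypothesis p_gt0 : (0 < p)%N.

(** A lower bound free of [p], valid even for [p = 1], lets the root of the logarithm absorb
    additive constants. *)
Lemma ln_2p_ge_half : 2^-1 <= ln (2 * p%:R) :> R.
Proof.
apply: (@le_trans _ _ (ln 2)).
  rewrite -[leLHS]expRK ler_ln ?posrE ?expR_gt0//.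
  rewrite -[2^-1]opprK expRN -[leRHS]invrK lef_pV2 ?posrE ?expR_gt0 ?invr_gt0//.
  by have := expR_ge1Dx (- 2^-1 : R); lra.
have : (1 : R) <= p%:R by rewrite ler1n.
by move=> p1; rewrite ler_ln ?posrE//; lra.
Qed.

Lemma l1_unit_ball_process (f : 'rV[R]_p -> 'I_n -> R) (A : set 'rV[R]_p)
    (t0 : 'rV[R]_p) :
    A t0 -> (forall t, A t -> l1norm t <= 1) ->
    (forall t u, A t -> A u -> l2norm (f t \- f u) <= l2norm (t 0 \- u 0)) ->
  exists V : {ffun 'I_n -> bool} -> R,
    sign_avg V <= 131 * 100 * Num.sqrt (ln (2 * p%:R)) /\
    forall e t, A t -> `|sign_sum e (f t \- f t0)| <= V e.
Proof.
move=> At0 A1 fl; pose j0 := Ordinal p_gt0.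
set L := ln _; have L2 : 2^-1 <= L by exact: ln_2p_ge_half.
have L0 : 0 <= L by lra.
set r := Num.sqrt L.
have r0 : 0 <= r by exact: sqrtr_ge0.
have r2 : r ^+ 2 = L by exact: sqr_sqrtr.
have r1 : 2^-1 <= r by rewrite -(@ler_pXn2r _ 2)// ?nnegrE//; lra.
(* 13 is such that [a s ^+ 2 / 8 >= 21 * 4 ^+ s * L], which absorbs the at most
   [(2 * p) ^ (20 * 4 ^ s)] pairs of consecutive cells. *)
pose a s : R := 13 * 2 ^+ s * r.
have a_ge2 s : 2 <= a s.
  have : (1 : R) <= 2 ^+ s by rewrite exprn_ege1//; lra.
  by rewrite /a; nra.
(* The depth makes [4 ^ S] exceed both [p], so that the last tail vanishes, and [n], so that the
   last link costs at most 2. *)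
pose S := (n + p)%N.
have S4 : (S <= 4 ^ S)%N by exact/ltnW/ltn_expl.
have pS : (p <= 4 ^ S)%N by rewrite (leq_trans _ S4)// leq_addl.
have nS : (n <= 4 ^ S)%N by rewrite (leq_trans _ S4)// leq_addr.
have GE t : A t ->
    \sum_(s < S.+1) a s * (l1diam s t + l1diam s.+1 t) <= 13 * 100 * r.
  move=> /A1 t1; rewrite (eq_bigr (fun s : 'I__ =>
      13 * r * (2 ^+ s * (l1diam s t + l1diam s.+1 t)))); last first.
    by move=> s _; rewrite /a; ring.
  rewrite -mulr_sumr.
  have := sum_l1diam j0 pS t1.
  set s := \sum_(_ < _) _ => sle.
  apply: (@le_trans _ _ (13 * r * 100)); last lra.
  by rewrite ler_wpM2l ?mulr_ge0.
have HE t : A t -> n%:R * l1diam S.+1 t <= 2.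
  move=> /A1 t1; rewrite /l1diam l2tail_eq0// mulr0 add0r.
  rewrite mulrCA ler_piMr// ler_pdivrMr ?exprn_gt0// mul1r.
  by rewrite -natrX ler_nat.
have [V0 [V0avg V0le]] := chaining At0 (fun s t _ => l1code_lt j0 s t)
  (erefl _) (fun s t u At Au tu => le_trans (fl t u At Au)
    (l1code_diam (A1 t At) (A1 u Au) tu)) a_ge2 GE HE.
have {}V0avg : sign_avg V0 <= 5.
  apply: le_trans V0avg _.
  suff : \sum_(s < S.+1) (@l1codes p s * @l1codes p s.+1)%:R *
      expR (- (a s ^+ 2 / 8)) <= 2 by lra.
  apply: le_trans (geometric_sum_le2 S.+1); apply: ler_sum => s _.
  have p1 : (1 : R) <= p%:R by rewrite ler1n.
  have p2 : (2 : R) <= 2 * p%:R by lra.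
  have expL m : expR (- (m%:R * L)) = (2 * p%:R) ^- m.
    by rewrite expRN mulrC expRM_natr lnK// posrE; lra.
  (* What is left of each term is [(2 * p) ^- (4 ^ s)], at most [2 ^- s]; with a geometric sum of at
     most 2, the average is at most [1 + 2 * 2 = 5]. *)
  apply: (@le_trans _ _ ((2 * p%:R) ^+ (20 * 4 ^ s) * expR (- ((21 * 4 ^ s)%:R * L)))).
    apply: ler_pM; rewrite ?expR_ge0//.
      by rewrite -[2 * _]natrM -natrX ler_nat l1codes_mul.
    rewrite ler_expR lerN2 /a !exprMn r2 exprAC natrM natrX.
    have -> : (2 : R) ^+ 2 = 4 by lra.
    have : 0 <= 4 ^+ s * L :> R by rewrite mulr_ge0 ?exprn_ge0.
    by lra.
  have q0 : (2 * p%:R : R) != 0 by rewrite gt_eqF//; lra.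
  rewrite expL.
  have -> : (21 * 4 ^ s = 20 * 4 ^ s + 4 ^ s)%N by lia.
  rewrite exprD invfM mulrA mulfV ?expf_neq0// mul1r -exprVn.
  apply: (@le_trans _ _ (2^-1 ^+ (4 ^ s))).
    by rewrite lerXn2r ?nnegrE ?invr_ge0// ?lef_pV2 ?posrE//; lra.
  by rewrite ler_wiXn2l ?invr_ge0//; [lra|exact/ltnW/ltn_expl].
(* The average is at most [2 * (13 * 100 * r * 5 + 2) = 130 * 100 * r + 4], and [4 <= 100 * r] as
   [r >= 1 / 2]. *)
exists (fun e => 2 * (13 * 100 * r * V0 e + 2)); split; last exact: V0le.
rewrite sign_avgZ.
have -> : (fun e => 13 * 100 * r * V0 e + 2) =
    (fun e => 13 * 100 * r * V0 e) \+ (fun=> 2) by [].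
rewrite sign_avgD sign_avg_cst sign_avgZ.
have : 13 * 100 * r * sign_avg V0 <= 13 * 100 * r * 5 by rewrite ler_wpM2l// mulr_ge0.
lra.
Qed.

Lemma l2normZ {I : finType} (c : R) (b : I -> R) : 0 <= c ->
  l2norm (fun i => c * b i) = c * l2norm b.
Proof.
move=> c0; rewrite /l2norm; under eq_bigr do rewrite exprMn.
by rewrite -mulr_sumr sqrtrM ?sqr_ge0// sqrtr_sqr ger0_norm.
Qed.

(** The substitution [t0 + M *: t] and division by [D * M] reduce this to the unit ball. *)
Lemma l1_ball_process (g : 'rV[R]_p -> 'I_n -> R) (A : set 'rV[R]_p)
    (t0 : 'rV[R]_p) (M D : R) :
    0 < M -> 0 < D -> A t0 -> (forall t, A t -> l1norm (t - t0) <= M) ->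
    (forall t u, A t -> A u ->
      l2norm (g t \- g u) <= D * l2norm (fun j => (t - u) 0 j)) ->
  exists V : {ffun 'I_n -> bool} -> R,
    sign_avg V <= 131 * 100 * D * M * Num.sqrt (ln (2 * p%:R)) /\
    forall e t, A t -> `|sign_sum e (g t \- g t0)| <= V e.
Proof.
move=> M0 D0 At0 AM gl.
have DM0 : 0 < D * M by exact: mulr_gt0.
pose f t i : R := (D * M)^-1 * g (t0 + M *: t) i.
have A1 t : A (t0 + M *: t) -> l1norm t <= 1.
  move=> /AM; rewrite addrC addKr /l1norm.
  under eq_bigr do rewrite mxE normrM gtr0_norm//.
  by rewrite -mulr_sumr ger_pMr.
have fl t u : A (t0 + M *: t) -> A (t0 + M *: u) ->
    l2norm (f t \- f u) <= l2norm (t 0 \- u 0).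
  move=> At Au; have := gl _ _ At Au.
  have -> : f t \- f u =
      (fun i => (D * M)^-1 * (g (t0 + M *: t) \- g (t0 + M *: u)) i).
    by apply/funext => i; rewrite /f /= mulrBr.
  have -> : (fun j => (t0 + M *: t - (t0 + M *: u)) 0 j) =
      (fun j => M * (t 0 \- u 0) j).
    by apply/funext => j; rewrite !mxE /=; ring.
  rewrite !l2normZ ?invr_ge0 ?(ltW M0) ?(ltW DM0)//.
  by rewrite mulrA -ler_pdivrMl.
have [|V [Vavg Vle]] := @l1_unit_ball_process f [set t | A (t0 + M *: t)] 0 _ A1 fl.
  by rewrite /= scaler0 addr0.
exists (fun e => D * M * V e); split.
  rewrite sign_avgZ [leRHS](_ : _ = D * M * (131 * 100 * Num.sqrt (ln (2 * p%:R)))).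
    by rewrite ler_pM2l.
  by ring.
move=> e t At.
have tE : t0 + M *: (M^-1 *: (t - t0)) = t.
  by rewrite scalerA mulfV ?gt_eqF// scale1r addrC subrK.
have := Vle e (M^-1 *: (t - t0)); rewrite /= tE => /(_ At).
rewrite -(ler_pM2l DM0); apply: le_trans.
rewrite -[D * M in leRHS](gtr0_norm DM0) -normrM.
suff -> : sign_sum e (g t \- g t0) =
  D * M * sign_sum e (f (M^-1 *: (t - t0)) \- f 0) by [].
rewrite /sign_sum mulr_sumr; apply: eq_bigr => i _.
rewrite /f /= tE scaler0 addr0; field.
by rewrite !gt_eqF.
Qed.

End L1BallProcess.

(** * Rayleigh quotients *)

Section Rayleigh.
Context {R : realType} {p : nat}.
Implicit Types (A : 'M[R]_p) (u v : 'rV[R]_p).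

Definition quadratic_form A u : R := (u *m A *m u^T) 0 0.

Lemma quadratic_formE A u :
  quadratic_form A u = \sum_j \sum_i u 0 i * A i j * u 0 j.
Proof.
rewrite /quadratic_form mxE; apply: eq_bigr => j _.
by rewrite !mxE mulr_suml.
Qed.

Lemma quadratic_form_scalar a u :
  quadratic_form a%:M u = a * \sum_j u 0 j ^+ 2.
Proof.
rewrite quadratic_formE mulr_sumr; apply: eq_bigr => j _.
rewrite (bigD1 j)//= big1 => [|i /negPf ij]; rewrite !mxE ?eqxx ?ij; last first.
  by rewrite mulr0n mulr0 mul0r.
by rewrite mulr1n addr0; ring.
Qed.

Lemma quadratic_formBl A B u :
  quadratic_form (A - B) u = quadratic_form A u - quadratic_form B u.
Proof. by rewrite /quadratic_form mulmxBr mulmxBl !mxE. Qed.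

Lemma quadratic_formZ A a u :
  quadratic_form A (a *: u) = a ^+ 2 * quadratic_form A u.
Proof.
rewrite !quadratic_formE mulr_sumr; apply: eq_bigr => j _.
by rewrite mulr_sumr; apply: eq_bigr => i _; rewrite !mxE; ring.
Qed.

Lemma continuous_quadratic_form A : continuous (quadratic_form A).
Proof.
have -> : quadratic_form A = fun u => \sum_j \sum_i u 0 i * A i j * u 0 j.
  by apply/funext => u; exact: quadratic_formE.
move=> u.
have cvg_term i j : (fun w => w 0 i * A i j * w 0 j) @ u --> u 0 i * A i j * u 0 j.
  apply: (@cvgM _ _ (nbhs u)); last exact: coord_continuous.
  by apply: (@cvgM _ _ (nbhs u)); [exact: coord_continuous|exact: cvg_cst].
apply: (@cvg_big _ _ _ _ _ _ _ (nbhs u)) => [|j _]; first exact: add_continuous.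
apply: (@cvg_big _ _ _ _ _ _ _ (nbhs u)) => [|i _]; first exact: add_continuous.
exact: cvg_term.
Qed.

(** If [y = u *m A] were nonzero, a small step from [u] along [- y] would make the form negative,
    its linear term being [- 2 * s] times the squared norm of [y]. *)
Lemma psd_form_kernel A u : A^T = A -> (forall v, 0 <= quadratic_form A v) ->
  quadratic_form A u = 0 -> u *m A = 0.
Proof.
move=> symA psdA Au; set y := u *m A.
have yy s : quadratic_form A (u - s *: y) =
    s ^+ 2 * quadratic_form A y - 2 * s * \sum_j y 0 j ^+ 2.
  rewrite /quadratic_form.
  have -> : (u - s *: y)^T = u^T - s *: y^T by rewrite linearB linearZ.
  rewrite mulmxBl mulmxBr !mulmxBl.
  rewrite -!scalemxAl -!scalemxAr -/y.
  have -> : y *m A *m u^T = y *m y^T by rewrite -mulmxA -{1}symA -trmx_mul.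
  have -> : y *m u^T = 0.
    by apply/rowP => i; rewrite !ord1 -[LHS]/(quadratic_form A u) Au mxE.
  have yyE : (y *m y^T) 0 0 = \sum_j y 0 j ^+ 2.
    by rewrite [LHS]mxE; apply: eq_bigr => j _; rewrite [y^T _ _]mxE expr2.
  rewrite -yyE; move: (y *m y^T) (y *m A *m y^T) => B C.
  rewrite !mxE; ring.
have nn : 0 <= \sum_j y 0 j ^+ 2 by rewrite sumr_ge0// => j _; exact: sqr_ge0.
suff y0 : \sum_j y 0 j ^+ 2 = 0.
  apply/rowP => j; rewrite [RHS]mxE.
  have /psumr_eq0P := y0 => /(_ (fun j _ => sqr_ge0 _) j isT)/eqP.
  by rewrite sqrf_eq0 => /eqP.
set z := \sum_j _ in yy nn *; have q0 := psdA y.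
set q := quadratic_form A y in yy q0.
apply/eqP; rewrite eq_le nn andbT leNgt; apply/negP => z0.
(* The step [z / (q + 1)] is near the minimizer [z / q] but stays defined for [q = 0]. *)
have := psdA (u - (z / (q + 1)) *: y); rewrite yy.
have -> : (z / (q + 1)) ^+ 2 * q - 2 * (z / (q + 1)) * z =
   - (z / (q + 1)) ^+ 2 * (q + 2).
  by field; rewrite gt_eqF// ltr_wpDl.
by rewrite mulNr oppr_ge0 leNgt mulr_gt0 ?exprn_gt0 ?divr_gt0// ltr_wpDl.
Qed.

(* A maximizer of the form on the unit sphere is an eigenvector. *)
Lemma quadratic_form_le_eigenvalue A u : A^T = A -> u != 0 -> exists2 a,
  eigenvalue A a & quadratic_form A u <= a * \sum_j u 0 j ^+ 2.
Proof.
move=> symA u0.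
have sumsq_gt0 (v : 'rV[R]_p) : v != 0 -> 0 < \sum_j v 0 j ^+ 2.
  move=> /eqP v0; rewrite lt_def sumr_ge0 ?andbT => [|j _]; last exact: sqr_ge0.
  apply/eqP => /psumr_eq0P => /(_ (fun j _ => sqr_ge0 _)) h; apply: v0.
  by apply/rowP => j; rewrite mxE; have /eqP := h j isT; rewrite sqrf_eq0 => /eqP.
pose K := [set v : 'rV[R]_p | \sum_j v 0 j ^+ 2 = 1].
have nrmK (v : 'rV[R]_p) : v != 0 ->
    K ((Num.sqrt (\sum_j v 0 j ^+ 2))^-1 *: v).
  move=> v0; have s0 := sumsq_gt0 _ v0; rewrite /K/=.
  under eq_bigr do rewrite mxE exprMn exprVn (sqr_sqrtr (ltW s0)).
  by rewrite -mulr_sumr mulVf// gt_eqF.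
have sumsq_cont : continuous (fun v : 'rV[R]_p => \sum_j v 0 j ^+ 2).
  have -> : (fun v : 'rV[R]_p => \sum_j v 0 j ^+ 2) = quadratic_form 1%:M.
    by apply/funext => v; rewrite quadratic_form_scalar mul1r.
  exact: continuous_quadratic_form.
have compK : compact K.
  have cube : compact [set v : 'rV[R]_p | forall j, `[(-1 : R), 1]%classic (v ord0 j)].
    by apply: (@rV_compact _ _ (fun=> `[(-1 : R), 1]%classic)) => _;
      exact: segment_compact.
  apply: subclosed_compact cube _.
    apply: (@preimage_closed _ _ _ [set 1 : R]); last exact: closed_eq.
    by move=> v _; exact: sumsq_cont.
  move=> v /= Kv j; rewrite /= in_itv/= -ler_norml.
  rewrite -(@ler_pXn2r _ 2)// ?nnegrE// expr1n real_normK ?num_real//.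
  by rewrite -Kv (bigD1 j)//= lerDl sumr_ge0// => k _; exact: sqr_ge0.
have [||v] := @compact_EVT_max _ _ (quadratic_form A) K _ compK.
- by exists ((Num.sqrt (\sum_j u 0 j ^+ 2))^-1 *: u); exact: nrmK.
- exact/continuous_subspaceT/continuous_quadratic_form.
rewrite inE => Kv vmax; set a := quadratic_form A v in vmax.
have amax w : quadratic_form A w <= a * \sum_j w 0 j ^+ 2.
  have [->|w0] := eqVneq w 0.
    rewrite -[0](scale0r (0 : 'rV[R]_p)) quadratic_formZ expr0n mul0r.
    by rewrite big1 ?mulr0// => j _; rewrite !mxE mul0r expr0n.
  have := vmax _ (mem_set (nrmK _ w0)); rewrite quadratic_formZ exprVn.
  by rewrite sqr_sqrtr ?(ltW (sumsq_gt0 _ w0))// mulrC ler_pdivrMr ?sumsq_gt0.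
exists a; last exact: amax.
apply/eigenvalueP; exists v; last first.
  apply/eqP => v0; move: Kv; rewrite /K/= v0 big1 => [|j _].
    by move/eqP; rewrite eq_sym oner_eq0.
  by rewrite mxE expr0n.
(* By maximality [a%:M - A] is positive semidefinite, and its form vanishes at [v], so [v] lies in
   its kernel. *)
have : v *m (a%:M - A) = 0.
  apply: psd_form_kernel; first by rewrite linearB/= tr_scalar_mx symA.
    by move=> w; rewrite quadratic_formBl quadratic_form_scalar subr_ge0.
  by rewrite quadratic_formBl quadratic_form_scalar Kv mulr1 subrr.
by rewrite mulmxBr mul_mx_scalar => /eqP; rewrite subr_eq0 => /eqP.
Qed.

Lemma quadratic_form_le_largest A a u : A^T = A ->
  is_largest_eigenvalue A a -> quadratic_form A u <= a * \sum_j u 0 j ^+ 2.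
Proof.
move=> symA [_ amax]; have s0 : 0 <= \sum_j u 0 j ^+ 2.
  by rewrite sumr_ge0// => j _; exact: sqr_ge0.
have [->|u0] := eqVneq u 0.
  rewrite -[0](scale0r (0 : 'rV[R]_p)) quadratic_formZ expr0n mul0r.
  by rewrite big1 ?mulr0// => j _; rewrite !mxE mul0r expr0n.
have [b bA /le_trans] := quadratic_form_le_eigenvalue symA u0; apply.
by rewrite ler_wpM2r// amax.
Qed.

Lemma quadratic_form_ge_smallest A a u : A^T = A ->
  is_smallest_eigenvalue A a -> a * \sum_j u 0 j ^+ 2 <= quadratic_form A u.
Proof.
move=> symA [ea amin]; rewrite -lerN2 -mulNr.
have -> : - quadratic_form A u = quadratic_form (- A) u.
  by rewrite /quadratic_form mulmxN mulNmx [RHS]mxE.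
have eigenN B b : eigenvalue B b -> eigenvalue (- B) (- b).
  move=> /eigenvalueP[v vB v0]; apply/eigenvalueP; exists v => //.
  by rewrite mulmxN vB scaleNr.
apply: quadratic_form_le_largest; first by rewrite linearN/= symA.
split; first exact: eigenN.
by move=> b /eigenN; rewrite opprK lerNr => /amin.
Qed.

End Rayleigh.

(** * The bound for fixed X *)

Section EmpiricalBound.
Context {T : Type} {R : realType} {n p : nat}.
Hypotheses (n_gt0 : (0 < n)%N) (p_gt0 : (0 < p)%N).
Variables (psi : 'I_p -> T -> 'I_n -> R) (x : 'I_n -> T).

Lemma tr_Sigma_mx : (Sigma_mx psi x)^T = Sigma_mx psi x.
Proof.
rewrite /Sigma_mx linearZ/= linear_sum; congr (_ *: _).
by apply: eq_bigr => i _; rewrite [LHS]trmx_mul trmxK.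
Qed.

Lemma quadratic_form_Sigma (v : 'rV[R]_p) : quadratic_form (Sigma_mx psi x) v =
  n%:R^-1 * \sum_(i < n) (\sum_j v 0 j * psi j (x i) i) ^+ 2.
Proof.
rewrite /quadratic_form /Sigma_mx -scalemxAr -scalemxAl mxE mulmx_sumr mulmx_suml.
rewrite summxE; congr (_ * _); apply: eq_bigr => i _.
have vE : (v *m psi_col psi (x i) i) 0 0 = \sum_j v 0 j * psi j (x i) i.
  by rewrite mxE; apply: eq_bigr => j _; rewrite mxE.
rewrite mulmxA -(mulmxA _ (psi_col _ _ _)^T) -trmx_mul; set B := v *m _ in vE *.
by rewrite [LHS]mxE big_ord1 [B^T _ _]mxE vE expr2.
Qed.

Lemma empirical_norm_le_K_max j : empirical_norm (psi j) x <= K_max psi x.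
Proof. by rewrite /K_max (bigD1 j)//= le_max lexx. Qed.

(** The form of Sigma_n at a basis vector is the squared empirical norm of one [psi j]. *)
Lemma sqrt_smallest_le_K_max (a : R) : 0 <= a ->
  is_smallest_eigenvalue (Sigma_mx psi x) (a ^+ 2) -> a <= K_max psi x.
Proof.
move=> a0 amin; pose j := Ordinal p_gt0.
apply: le_trans (empirical_norm_le_K_max j).
have := quadratic_form_ge_smallest (delta_mx 0 j) tr_Sigma_mx amin.
rewrite quadratic_form_Sigma (bigD1 j)//= mxE !eqxx big1 => [|k /negPf kj]; last first.
  by rewrite mxE kj andbF expr0n.
rewrite expr1n addr0 mulr1 => h.
rewrite -[leLHS](ger0_norm a0) -sqrtr_sqr ler_wsqrtr// (le_trans h)//.
rewrite ler_pM2l ?invr_gt0 ?ltr0n//; apply: ler_sum => i _.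
rewrite (bigD1 j)//= big1 => [|k /negPf kj]; last by rewrite mxE kj andbF mul0r.
by rewrite mxE !eqxx addr0 mul1r.
Qed.

Variables (rho : 'rV[R]_p -> T -> R) (c : 'I_n -> 'rV[R]_p -> R).
Variables (A : set 'rV[R]_p) (theta0 : 'rV[R]_p) (M lmin lmax : R).
Hypotheses (A_theta0 : A theta0) (M_gt0 : 0 < M).
Hypothesis lip : forall theta theta', A theta -> A theta' -> forall i : 'I_n,
  `| (rho theta (x i) - c i theta) - (rho theta' (x i) - c i theta') |
    <= \sum_(j < p) `|theta 0 j - theta' 0 j| * psi j (x i) i.
Hypotheses (lmin_gt0 : 0 < lmin) (lmax_ge0 : 0 <= lmax).
Hypothesis lminE : is_smallest_eigenvalue (Sigma_mx psi x) (lmin ^+ 2).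
Hypothesis lmaxE : is_largest_eigenvalue (Sigma_mx psi x) (lmax ^+ 2).

Let g theta i := compensated_loss rho c theta (x i) i.

Let lmin_le_lmax : lmin <= lmax.
Proof.
rewrite -(@ler_pXn2r _ 2)// ?nnegrE ?(ltW lmin_gt0)//.
by case: lminE => _; apply; case: lmaxE.
Qed.

Let g_lipschitz theta theta' : A theta -> A theta' ->
  l2norm (g theta \- g theta')
    <= Num.sqrt n%:R * lmax * l2norm (fun j => (theta - theta') 0 j).
Proof.
move=> At At'; set D := _ * lmax; have D0 : 0 <= D by rewrite mulr_ge0 ?sqrtr_ge0.
rewrite -(@ler_pXn2r _ 2)// ?nnegrE ?mulr_ge0 ?l2norm_ge0//.
rewrite exprMn !sqr_l2norm exprMn sqr_sqrtr ?ler0n//.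
(* The Lipschitz bound is linear in these absolute values, and [v] has the same l2-norm as the
   difference, so the Rayleigh bound at [v] suffices. *)
pose v : 'rV[R]_p := \row_j `|theta 0 j - theta' 0 j|.
have -> : \sum_j (theta - theta') 0 j ^+ 2 = \sum_j v 0 j ^+ 2.
  by apply: eq_bigr => j _; rewrite !mxE real_normK// num_real.
have := quadratic_form_le_largest v tr_Sigma_mx lmaxE.
rewrite quadratic_form_Sigma ler_pdivrMl ?ltr0n// mulrA; apply: le_trans.
apply: ler_sum => i _.
have := lip At At' i.
rewrite [X in _ <= X -> _](_ : _ = \sum_j v 0 j * psi j (x i) i); last first.
  by apply: eq_bigr => j _; rewrite mxE.
(* the bound is nonnegative because it dominates an absolute value, although
   some psi_j may be negative *)
move=> h; rewrite -real_normK ?num_real// ler_pXn2r// nnegrE.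
by rewrite (le_trans _ h).
Qed.

Lemma symmetrized_process_bound :
  exists V : {ffun 'I_n -> bool} -> R,
    sign_avg V <= 131 * 100 * M * Num.sqrt (2 * ln (2 * p%:R) / n%:R)
                    * K_max psi x * (lmax / lmin) /\
    forall (e : {ffun 'I_n -> bool}) theta, l1ball_in A theta0 M theta ->
      `|symmetrized_process rho c (fun i => (-1) ^+ e i) x theta theta0| <= V e.
Proof.
have n0 : (0 : R) < n%:R by rewrite ltr0n.
have lmax_gt0 : 0 < lmax by exact: lt_le_trans lmin_le_lmax.
have D0 : 0 < Num.sqrt n%:R * lmax by rewrite mulr_gt0 ?sqrtr_gt0.
have B0 : l1ball_in A theta0 M theta0.
  split=> //; rewrite subrr /l1norm big1 ?(ltW M_gt0)// => j _.
  by rewrite mxE normr0.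
have [V [Vavg Vle]] := @l1_ball_process R n p p_gt0 g (l1ball_in A theta0 M)
  theta0 M _ M_gt0 D0 B0 (fun t h => h.2) (fun t u h h' => g_lipschitz h.1 h'.1).
exists (fun e => n%:R^-1 * V e); split; last first.
  move=> e theta Bt; rewrite /symmetrized_process normrM gtr0_norm ?invr_gt0//.
  by rewrite ler_pM2l ?invr_gt0//; exact: Vle.
rewrite sign_avgZ ler_pdivrMl// (le_trans Vavg)//.
set L := ln _; have L0 : 0 <= L by apply: le_trans (ln_2p_ge_half p_gt0); rewrite invr_ge0.
have sqrtE : n%:R * Num.sqrt (2 * L / n%:R) = Num.sqrt n%:R * Num.sqrt (2 * L).
  rewrite sqrtrM ?mulr_ge0// sqrtrV ?ler0n//.
  rewrite -{1}(sqr_sqrtr (ltW n0)); field.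
  by rewrite gt_eqF// sqrtr_gt0.
have K0 : lmin <= K_max psi x by exact: sqrt_smallest_le_K_max (ltW _) _.
(* [lmin <= K_max] turns [lmax] into the product with the condition ratio. *)
have KL : lmax <= K_max psi x * (lmax / lmin).
  by rewrite mulrCA ler_peMr// ler_pdivlMr// mul1r.
have LL : Num.sqrt L <= Num.sqrt (2 * L) by rewrite ler_wsqrtr//; lra.
rewrite -[X in _ <= n%:R * X]mulrA.
have -> : n%:R * (131 * 100 * M * Num.sqrt (2 * L / n%:R) * (K_max psi x * (lmax / lmin)))
   = 131 * 100 * M * (n%:R * Num.sqrt (2 * L / n%:R)) * (K_max psi x * (lmax / lmin)).
  by ring.
rewrite sqrtE.
have -> : 131 * 100 * (Num.sqrt n%:R * lmax) * M * Num.sqrt L =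
    131 * 100 * M * (Num.sqrt n%:R * Num.sqrt L) * lmax by ring.
apply: ler_pM => //; rewrite ?mulr_ge0 ?sqrtr_ge0 ?(ltW M_gt0)//.
by rewrite ler_wpM2l ?mulr_ge0 ?(ltW M_gt0)// ler_wpM2l ?sqrtr_ge0.
Qed.

End EmpiricalBound.

(** * Conditional expectation *)

Section AlmostEverywhere.
Context {d : measure_display} {Omega : measurableType d} {R : realType}.
Variable P : probability Omega R.
Import HBNNSimple.

Lemma negligible_bigcup_countable (J : countType) (F : J -> set Omega) :
  (forall j, P.-negligible (F j)) -> P.-negligible (\bigcup_j F j).
Proof.
move=> Fnull; pose F' k := if unpickle k is Some j then F j else set0.
apply: (@negligibleS _ _ _ _ (\bigcup_k F' k)).
  by move=> w [j _ Fj]; exists (pickle j) => //; rewrite /F' pickleK.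
apply: negligible_bigcup => k; rewrite /F'.
by case: unpickle => [j|]; [exact: Fnull|exact: negligible_set0].
Qed.

(* For a nonmeasurable [f] the integral is the lower integral, the supremum over
   the simple functions below [f]. *)
Lemma ae_le_integral_lower (A N : set Omega) (f g : Omega -> \bar R) :
    measurable A -> (forall w, 0 <= f w)%E ->
    measurable_fun setT g -> (forall w, 0 <= g w)%E -> P.-negligible N ->
    (forall w, A w -> ~ N w -> (f w <= g w)%E) ->
  (\int[P]_(w in A) f w <= \int[P]_(w in A) g w)%E.
Proof.
move=> mA f0 mg g0 Nnull fg.
rewrite ge0_integralE//; apply: ge_ereal_sup => _ [h hf <-].
rewrite -integralT_nnsfun [leRHS]integral_mkcond.
apply: ae_ge0_le_integral => //.
- by move=> w _; rewrite lee_fin.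
- by apply/measurable_EFinP.
- by move=> w _; rewrite patchE; case: ifP.
- by apply: (measurable_restrictT g mA).1; exact: measurable_funTS.
apply: (negligibleS _ Nnull) => w /=; apply: contra_notP => Nw _.
apply: le_trans (hf w) _; rewrite !patchE; case: ifPn => //.
by rewrite inE => Aw; exact: fg.
Qed.

(** On [A], [f] is almost surely at most the step function with value [r i] on [E i], whose integral
    over [A] is [(\sum_i q i * r i) * P A] by independence. As [Z >= z] there, [z * P A] is at most
    that integral, which forces [P A = 0]. *)
Lemma cond_expectation_gap_null (I : finType) (C : set (set Omega))
    (f Z : Omega -> \bar R) (E : I -> set Omega) (q r : I -> R) (z : R)
    (A N : set Omega) :
    <<s C >> `<=` measurable -> is_cond_expectation P <<s C >> f Z ->
    (forall w, 0 <= f w)%E ->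
    (forall i, measurable (E i)) -> (forall i, P (E i) = (q i)%:E) ->
    (forall i B, <<s C >> B -> P (E i `&` B) = (P (E i) * P B)%E) ->
    <<s C >> A -> P.-negligible N -> (forall i, 0 <= r i) ->
    (forall w, A w -> ~ N w -> exists2 i, E i w & (f w <= (r i)%:E)%E) ->
    (forall w, A w -> (z%:E <= Z w)%E) -> \sum_i q i * r i < z ->
  P A = 0%E.
Proof.
move=> CM [mZ intZ] f0 mE PE indep CA Nnull r0 fr zZ qrz.
have mA := CM _ CA.
have q0 i : 0 <= q i by rewrite -lee_fin -PE.
have z0 : 0 <= z by apply: le_trans (ltW qrz); rewrite sumr_ge0// => i _; rewrite mulr_ge0.
pose g w := (\sum_i (r i)%:E * (\1_(E i) w)%:E)%E : \bar R.
have mt i : measurable_fun setT (fun w => (r i)%:E * (\1_(E i) w)%:E : \bar R)%E.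
  apply: emeasurable_funM => //; apply/measurable_EFinP; exact: measurable_indic.
have t0 i w : (0 <= (r i)%:E * (\1_(E i) w)%:E :> \bar R)%E.
  by rewrite mule_ge0 ?lee_fin.
have g0 w : (0 <= g w)%E by rewrite sume_ge0.
have fg : (\int[P]_(w in A) f w <= \int[P]_(w in A) g w)%E.
  apply: (ae_le_integral_lower mA f0 _ g0 Nnull).
    by apply: emeasurable_sum => i; exact: mt.
  move=> w Aw Nw; have [i Ei /le_trans] := fr _ Aw Nw; apply.
  rewrite /g (bigD1 i)//= indicE mem_set// mule1 leeDl//.
  by rewrite sume_ge0.
have intg : (\int[P]_(w in A) g w = (\sum_i q i * r i)%:E * P A)%E.
  rewrite ge0_integral_sum//; last by move=> i; exact: measurable_funTS.
  rewrite -sumEFin ge0_sume_distrl => [|i _]; last by rewrite lee_fin mulr_ge0.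
  apply: eq_bigr => i _; rewrite ge0_integralZl ?lee_fin//; last first.
    by apply: measurable_funTS; apply/measurable_EFinP; exact: measurable_indic.
  have PEA : P (E i `&` A) = ((q i)%:E * P A)%E by rewrite indep// PE.
  rewrite integral_indic//; transitivity ((r i)%:E * ((q i)%:E * P A))%E.
    by congr (_ * _)%E.
  by rewrite muleA -EFinM mulrC.
have zA : (z%:E * P A <= \int[P]_(w in A) Z w)%E.
  rewrite -integral_cst//; apply: ge0_le_integral => //.
  by move=> _ B mB; apply: measurableI => //; apply: CM; exact: mZ.
have : (z%:E * P A <= (\sum_i q i * r i)%:E * P A)%E.
  by apply: le_trans zA _; rewrite intZ// -intg.
have PAfin : P A \is a fin_num by exact: fin_num_measure.
rewrite -(fineK PAfin) -!EFinM lee_fin => h.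
congr EFin; apply/eqP; rewrite eq_le fine_ge0// andbT leNgt; apply/negP => PA0.
by move: h; rewrite ler_pM2r// leNgt qrz.
Qed.

End AlmostEverywhere.

(** * Reduction of the supremum to countably many parameters *)

Section DenseSequence.
Context {R : realType} {p : nat}.

(** The sequence must stay in [A], which may contain no rational point, so a point of [A] is picked
    in each rational cube that meets it. *)
Lemma l1_dense_sequence (A : set 'rV[R]_p) (a0 : 'rV[R]_p) : A a0 ->
  exists D : nat -> 'rV[R]_p, (forall k, A (D k)) /\
    forall t, A t -> forall e : R, 0 < e -> exists k, l1norm (t - D k) <= e.
Proof.
move=> Aa0.
pose cube (q : {ffun 'I_p -> rat} * nat) := [set t : 'rV[R]_p | A t /\
  forall j, `|t 0 j - ratr (q.1 j)| <= q.2.+1%:R^-1].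
exists (fun k => if unpickle k is Some q then xget a0 (cube q) else a0); split.
  by move=> k; case: unpickle => // q; case: xgetP => [u -> []|].
move=> t At e e0.
(* Two points of one cube differ by at most [2 * dl] in each of [p] coordinates. *)
pose m := Num.truncn (2 * p%:R / e); pose dl : R := m.+1%:R^-1.
have dl0 : 0 < dl by rewrite invr_gt0.
have dle : p%:R * (2 * dl) <= e.
  have /andP[_ /ltW h] : (m%:R <= 2 * p%:R / e < m.+1%:R)%R.
    by apply: truncn_itv; rewrite divr_ge0 ?mulr_ge0// ltW.
  by rewrite mulrCA mulrA ler_pdivrMr// [e * _]mulrC -ler_pdivrMr//.
have ratnear j : {q : rat | `|t 0 j - ratr q| <= dl}.
  apply: cid; have [|q] := @rat_in_itvoo R (t 0 j) (t 0 j + dl).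
    by rewrite ltrDl.
  by rewrite in_itv/= => /andP[h1 h2]; exists q; rewrite ler_norml; lra.
pose q : {ffun 'I_p -> rat} := [ffun j => sval (ratnear j)].
exists (pickle (q, m)); rewrite /= pickleK.
have qt : cube (q, m) t.
  by split=> // j; rewrite ffunE; exact: (svalP (ratnear j)).
case: xgetP => [u -> [_ /= uq]|/(_ t)//].
apply: le_trans dle; apply: (@le_trans _ _ (\sum_(j < p) (2 * dl))); last first.
  by rewrite sumr_const card_ord -[_ *+ p]mulr_natl.
apply: ler_sum => j _; rewrite !mxE (le_trans (ler_distD (ratr (q j)) _ _))//.
by rewrite mulr_natl mulr2n lerD ?qt.2// distrC.
Qed.

End DenseSequence.

(** For a fixed sample the process is Lipschitz in the l1-norm, with the sample average of the sums
    of [|psi j|] as constant. *)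
Lemma symmetrized_process_dense (R : realType) (T : Type) (n p : nat)
    (rho : 'rV[R]_p -> T -> R) (c : 'I_n -> 'rV[R]_p -> R)
    (psi : 'I_p -> T -> 'I_n -> R) (x : 'I_n -> T) (s : 'I_n -> R)
    (A B : set 'rV[R]_p) (t0 t : 'rV[R]_p) (D : nat -> 'rV[R]_p) (r : R) :
    (forall i, `|s i| <= 1) -> B `<=` A ->
    (forall u v, A u -> A v -> forall i : 'I_n,
      `| (rho u (x i) - c i u) - (rho v (x i) - c i v) |
        <= \sum_(j < p) `|u 0 j - v 0 j| * psi j (x i) i) ->
    (forall k, B (D k)) -> B t ->
    (forall e : R, 0 < e -> exists k, l1norm (t - D k) <= e) ->
    (forall k, `|symmetrized_process rho c s x (D k) t0| <= r) ->
  `|symmetrized_process rho c s x t t0| <= r.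
Proof.
move=> s1 BA lip BD Bt tD Dr.
pose K := n%:R^-1 * \sum_(i < n) \sum_(j < p) `|psi j (x i) i|.
have K0 : 0 <= K.
  by rewrite mulr_ge0 ?invr_ge0// sumr_ge0// => i _; rewrite sumr_ge0.
have diff k : `|symmetrized_process rho c s x t t0 -
    symmetrized_process rho c s x (D k) t0| <= K * l1norm (t - D k).
  rewrite /symmetrized_process -mulrBr -sumrB normrM ger0_norm ?invr_ge0//.
  rewrite /K -mulrA ler_wpM2l ?invr_ge0// mulr_suml.
  apply: le_trans (ler_norm_sum _ _ _) _; apply: ler_sum => i _.
  have cancel (u v w : R) : u - w - (v - w) = u - v by ring.
  rewrite -mulrBr normrM cancel -[leRHS]mul1r.
  apply: ler_pM => //; apply: (le_trans (lip _ _ (BA _ Bt) (BA _ (BD k)) i)).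
  rewrite mulr_suml; apply: ler_sum => j _; rewrite mulrC.
  apply: (le_trans (ler_norm _)); rewrite normrM normr_id ler_wpM2l//.
  by have := normr_le_l1norm (t - D k) j; rewrite !mxE.
apply/ler_addgt0Pr => e e0.
(* Adding 1 covers [K = 0]. *)
have [|k tk] := tD (e / (K + 1)); first by rewrite divr_gt0// ltr_wpDl.
set y := symmetrized_process _ _ _ _ t _ in diff *.
pose yk := symmetrized_process rho c s x (D k) t0.
have -> : y = yk + (y - yk) by rewrite addrC subrK.
apply: (le_trans (ler_normD _ _)); apply: lerD; first exact: Dr.
apply: (le_trans (diff k)); apply: (@le_trans _ _ (K * (e / (K + 1)))).
  by rewrite ler_wpM2l.
rewrite mulrCA ler_piMr ?(ltW e0)// ler_pdivrMr ?ltr_wpDl// mul1r.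
by rewrite lerDl.
Qed.

(** * Events of the sigma-algebra generated by the sample *)

Section SigmaPreimage.
Context {d d' : measure_display} {Omega : measurableType d}
  {T : measurableType d'} {n : nat}.
Variable X : 'I_n -> Omega -> T.

Lemma g_sigma_preimage_proj i (B : set T) :
  measurable B -> g_sigma_preimage X (X i @^-1` B).
Proof.
move=> mB; apply: sub_sigma_algebra; rewrite (bigD1 i)//=; left.
by exists B => //; rewrite setTI.
Qed.

Lemma g_sigma_preimage_sub : (forall i, measurable_fun setT (X i)) ->
  g_sigma_preimage X `<=` measurable.
Proof.
move=> mX; apply: smallest_sub; first exact: sigma_algebra_measurable.
apply: (big_ind (fun S => S `<=` measurable)) => //.
  by move=> S1 S2 h1 h2 B [/h1|/h2].
by move=> i _ _ [B mB <-]; exact: mX.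
Qed.

Let C := \big[setU/set0]_(i < n) preimage_set_system setT (X i) measurable.

Lemma g_sigma_preimageI (A B : set Omega) : g_sigma_preimage X A ->
  g_sigma_preimage X B -> g_sigma_preimage X (A `&` B).
Proof.
by move=> mA mB; exact: (@measurableI _ (g_sigma_algebraType C)).
Qed.

Lemma g_sigma_preimage_fin_bigcap (I : Type) (J : set I) (F : I -> set Omega) :
  finite_set J -> (forall i, J i -> g_sigma_preimage X (F i)) ->
  g_sigma_preimage X (\bigcap_(i in J) F i).
Proof.
by move=> fJ mF; exact: (@fin_bigcap_measurable _ (g_sigma_algebraType C)).
Qed.

(** With deterministic signs and countably many parameters, this is a countable intersection of
    events of sigma(X). *)
Lemma sigma_process_le {R : realType} {p : nat} (rho : 'rV[R]_p -> T -> R)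
    (c : 'I_n -> 'rV[R]_p -> R) (J : finType) (s : J -> 'I_n -> R)
    (t0 : 'rV[R]_p) (D : nat -> 'rV[R]_p) (r : J -> R) :
    (forall k, measurable_fun setT (rho (D k))) ->
    measurable_fun setT (rho t0) ->
  g_sigma_preimage X [set w | forall e k,
    `|symmetrized_process rho c (s e) (X ^~ w) (D k) t0| <= r e].
Proof.
move=> mD m0; pose TC := g_sigma_algebraType C.
have mX i : measurable_fun setT (X i : TC -> T).
  by move=> _ B mB; rewrite setTI; exact: g_sigma_preimage_proj.
have mY e k : measurable_fun setT (fun w : TC =>
    symmetrized_process rho c (s e) (X ^~ w) (D k) t0).
  apply: measurable_funM => //; apply: measurable_sum => i.
  apply: measurable_funM => //; apply: measurable_funB; apply: measurable_funB => //.
    by apply: measurableT_comp (mD k) (mX i).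
  by apply: measurableT_comp m0 (mX i).
rewrite (_ : [set w | _] = \bigcap_(e in [set: J]) \bigcap_k
  ((fun w => symmetrized_process rho c (s e) (X ^~ w) (D k) t0) @^-1`
    `[- r e, r e])); last first.
  apply/seteqP; split=> w /= h e.
    by move=> _ k _ /=; rewrite in_itv/= -ler_norml.
  by move=> k; have := h e I k I; rewrite /= in_itv/= -ler_norml.
apply: g_sigma_preimage_fin_bigcap => // e _.
apply: (@bigcap_measurableType _ TC) => k _.
by have := mY e k measurableT _ (measurable_itv `[- r e, r e]); rewrite setTI.
Qed.

End SigmaPreimage.

(** * Sign patterns as events *)

Section Rademacher.
Context {d : measure_display} {Omega : measurableType d} {R : realType}.
Context {P : probability Omega R} {n : nat}.
Variable eps : 'I_n -> {RV P >-> R}.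
Hypothesis eps_rademacher : rademacher P (fun i => eps i : Omega -> R).
Implicit Type e : {ffun 'I_n -> bool}.

Definition sign_event e : set Omega :=
  \bigcap_(i in [set` [set: 'I_n]%SET]) (eps i @^-1` [set (-1) ^+ e i]).

Lemma sign_eventP e w : sign_event e w -> (fun i => eps i w) = (fun i => (-1) ^+ e i).
Proof. by move=> Ew; apply/funext => i; have := Ew i; apply; rewrite /= inE. Qed.

Lemma probability_sign_event e : P (sign_event e) = (2^-1 ^+ n)%:E.
Proof.
have [indep half] := eps_rademacher.
rewrite indep; last by move=> i; exact: measurable_set1.
rewrite (eq_bigr (fun=> (2^-1)%:E)) => [|i _]; last first.
  by case: (half i) => h1 h2; case: (e i); rewrite ?expr1 ?expr0.
by rewrite prodEFin prodr_const cardsT card_ord.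
Qed.

Lemma measurable_sign_event e : measurable (sign_event e).
Proof.
by apply: fin_bigcap_measurable.
Qed.

Lemma sigma_sign_event e :
  g_sigma_preimage (fun i => eps i : Omega -> R) (sign_event e).
Proof.
apply: g_sigma_preimage_fin_bigcap => // i _.
by apply: g_sigma_preimage_proj; exact: measurable_set1.
Qed.

Lemma sign_events_cover : P.-negligible (~` \bigcup_e sign_event e).
Proof.
have [_ half] := eps_rademacher.
pose S i := eps i @^-1` [set 1] `|` eps i @^-1` [set -1].
have mS a i : measurable (eps i @^-1` [set a]).
  by apply: measurable_funPTI => //; exact: measurable_set1.
apply: (@negligibleS _ _ _ _ (\bigcup_i ~` S i)); last first.
  apply: negligible_bigcup_countable => i.
  apply/negligibleP; first by apply: measurableC; exact: measurableU.
  have PS : P (S i) = 1%E.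
    rewrite measureU//.
      by case: (half i) => /= -> ->; rewrite -EFinD; congr EFin; lra.
    apply/seteqP; split=> // w [/= h1 h2]; have := h1; rewrite h2 => /eqP.
    by rewrite lt_eqF// (lt_trans _ ltr01)// ltrN10.
  have := @probability_setC _ _ _ P _ (measurableU _ _ (mS 1 i) (mS (-1) i)).
  by rewrite -/(S i) PS subee.
move=> w /= nE; apply: contrapT => nS; apply: nE.
exists [ffun i => eps i w == -1] => // i _ /=; rewrite ffunE.
have [->//|ne] := eqVneq (eps i w) (-1).
rewrite expr0; apply: contrapT => h1; apply: nS; exists i => // -[//|/= h2].
by move/eqP: ne.
Qed.

End Rademacher.

(** * From the fixed-sample bound to the conditional expectation *)

Theorem theorem4p3 (R : realType) :
  exists C : R,
  forall (d d' : measure_display) (Omega : measurableType d)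
    (T : measurableType d') (P : probability Omega R)
    (n p : nat) (n_gt0 : (0 < n)%N) (p_gt0 : (0 < p)%N)
    (X : 'I_n -> {RV P >-> T})
    (X_indep : mutually_independent P (fun i => X i : Omega -> T))
    (eps : 'I_n -> {RV P >-> R})
    (eps_rademacher : rademacher P (fun i => eps i : Omega -> R))
    (eps_X_indep : independent_systems P
       (g_sigma_preimage (fun i => eps i : Omega -> R))
       (g_sigma_preimage (fun i => X i : Omega -> T)))
    (Theta Theta_star : set 'rV[R]_p)
    (Theta_starE : Theta_star = Theta \/ Theta_star = convex_hull Theta)
    (rho : 'rV[R]_p -> T -> R)
    (rho_meas : forall theta, Theta_star theta ->
       measurable_fun [set: T] (rho theta))
    (c : 'I_n -> 'rV[R]_p -> R)
    (theta0 : 'rV[R]_p) (Theta_theta0 : Theta theta0)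
    (M : R) (M_gt0 : 0 < M)
    (psi : 'I_p -> T -> 'I_n -> R)
    (rho_lip : {ae P, forall w,
       forall theta theta', Theta_star theta -> Theta_star theta' ->
       forall i : 'I_n,
         `| (rho theta (X i w) - c i theta) -
            (rho theta' (X i w) - c i theta') |
         <= \sum_(j < p) `|theta 0 j - theta' 0 j| * psi j (X i w) i})
    (lambda_min lambda_max : Omega -> R)
    (lambda_min_ge0 : forall w, 0 <= lambda_min w)
    (lambda_max_ge0 : forall w, 0 <= lambda_max w)
    (lambda_minE : forall w,
       is_smallest_eigenvalue (Sigma_mx psi (X ^~ w)) (lambda_min w ^+ 2))
    (lambda_maxE : forall w,
       is_largest_eigenvalue (Sigma_mx psi (X ^~ w)) (lambda_max w ^+ 2))
    (lambda_min_gt0 : {ae P, forall w, 0 < lambda_min w})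
    (Z : Omega -> \bar R)
    (Z_cond : is_cond_expectation P
       (g_sigma_preimage (fun i => X i : Omega -> T))
       (fun w => ereal_sup
          [set (`| symmetrized_process rho c (eps ^~ w) (X ^~ w)
                     theta theta0 |)%:E
          | theta in l1ball_in Theta_star theta0 M])
       Z),
  {ae P, forall w,
     (Z w <= (C * M * Num.sqrt (2 * ln (2 * p%:R) / n%:R)
                * K_max psi (X ^~ w) * (lambda_max w / lambda_min w))%:E)%E}.
Proof.
exists (131 * 100) => d d' Omega T P n p n_gt0 p_gt0 X _ eps eps_rademacher
  eps_X_indep Theta Theta_star Theta_starE rho rho_meas c theta0 Theta_theta0
  M M_gt0 psi rho_lip lambda_min lambda_max _ lambda_max_ge0
  lambda_minE lambda_maxE lambda_min_gt0 Z Z_cond.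
have star0 : Theta_star theta0.
  by case: Theta_starE => -> // B [_]; exact.
pose ball := l1ball_in Theta_star theta0 M.
have ball0 : ball theta0.
  split=> //; rewrite subrr /l1norm big1 ?(ltW M_gt0)// => j _.
  by rewrite mxE normr0.
have [D [ballD Ddense]] := l1_dense_sequence ball0.
pose sgn (e : {ffun 'I_n -> bool}) (i : 'I_n) : R := (-1) ^+ e i.
pose Y e w theta := symmetrized_process rho c (sgn e) (X ^~ w) theta theta0.
pose bound w := 131 * 100 * M * Num.sqrt (2 * ln (2 * p%:R) / n%:R)
  * K_max psi (X ^~ w) * (lambda_max w / lambda_min w).
(* Countably many sets [A j] of the sigma-algebra of [X] cover the bad event up
   to a null set, so that [psi], [lambda_min] and [lambda_max] need not be
   measurable. *)
pose A (j : {ffun {ffun 'I_n -> bool} -> rat} * rat) : set Omega :=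
  [set w | (forall e k, `|Y e w (D k)| <= ratr (j.1 e)) /\
           ((ratr j.2)%:E <= Z w)%E].
(* Rational levels whose average stays strictly below the level of [Z]: the gap that makes [A j]
   null. *)
pose admissible (j : {ffun {ffun 'I_n -> bool} -> rat} * rat) :=
  (forall e, 0 <= ratr (j.1 e) :> R) /\
  sign_avg (fun e => ratr (j.1 e) : R) < ratr j.2.
have [N [mN PN /= Nlip]] := filterI rho_lip lambda_min_gt0.
pose N' := N `|` ~` \bigcup_e sign_event eps e.
have N'null : P.-negligible N'.
  apply: negligibleU; last exact: sign_events_cover.
  exact/negligibleP.
have good w : ~ N' w -> (forall theta theta', Theta_star theta ->
    Theta_star theta' -> forall i : 'I_n,
      `| (rho theta (X i w) - c i theta) - (rho theta' (X i w) - c i theta') |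
      <= \sum_(j < p) `|theta 0 j - theta' 0 j| * psi j (X i w) i) /\
    0 < lambda_min w.
  by move=> Nw; apply: contrapT => bad; apply: Nw; left; exact: Nlip.
have sigmaX_sub : g_sigma_preimage (fun i => X i : Omega -> T) `<=` measurable.
  by apply: g_sigma_preimage_sub => i.
have sigmaA j : g_sigma_preimage (fun i => X i : Omega -> T) (A j).
  apply: g_sigma_preimageI; last first.
    by have := Z_cond.1 _ (emeasurable_itv `[(ratr j.2)%:E, +oo[);
      rewrite preimage_itvcy.
  apply: sigma_process_le => k; first exact/rho_meas/(ballD k).1.
  exact: rho_meas.
have A_null j : admissible j -> P (A j) = 0%E.
  move=> [r0 rz].
  apply: (@cond_expectation_gap_null _ _ _ P {ffun 'I_n -> bool} _ _ Z
    (sign_event eps) (fun=> 2^-1 ^+ n) (fun e => ratr (j.1 e)) (ratr j.2)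
    (A j) N' _ Z_cond _ _ _ _ _ N'null r0) => //.
  - move=> w; apply: le_trans (ereal_sup_ubound _); last by exists theta0.
    by rewrite lee_fin.
  - exact: measurable_sign_event.
  - by move=> e; exact: probability_sign_event.
  - by move=> e B XB; apply: eps_X_indep => //; exact: sigma_sign_event.
  - exact: sigmaA.
  - move=> w [Yr _] Nw; have [lip _] := good w Nw.
    have [e _ Ee] : (\bigcup_e sign_event eps e) w.
      by apply: contrapT => nE; apply: Nw; right.
    exists e => //; rewrite (sign_eventP Ee); apply: ge_ereal_sup.
    move=> _ [theta Btheta <-]; rewrite lee_fin.
    apply: (symmetrized_process_dense _ _ lip ballD Btheta (Ddense _ Btheta)).
    + by move=> i; rewrite normr_sign.
    + by move=> u [].
    + exact: Yr.
  - by move=> w [].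
  - by rewrite -mulr_sumr.
have : P.-negligible (N' `|` \bigcup_j [set w | admissible j /\ A j w]).
  apply: negligibleU => //; apply: negligible_bigcup_countable => j.
  have [adm|nadm] := pselect (admissible j).
    apply: (@negligibleS _ _ _ _ (A j)) => [w []//|].
    by apply/negligibleP; [exact: sigmaX_sub|exact: A_null].
  by apply: (@negligibleS _ _ _ _ set0) => [w []//|]; exact: negligible_set0.
apply: negligibleS => w /= /negP; rewrite -ltNge -/(bound w) => Bw.
have [|/good[lip lmin0]] := pselect (N' w); first by left.
right.
have [V [Vavg Vle]] := symmetrized_process_bound n_gt0 p_gt0 (x := X ^~ w) star0 M_gt0 lip lmin0
   (lambda_max_ge0 w) (lambda_minE w) (lambda_maxE w).
rewrite -/(bound w) in Vavg.
(* [Z w] may be infinite, hence a real level [z] between the bound and [Z w]. *)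
have [z Bz zZ] : exists2 z, bound w < z & (z%:E <= Z w)%E.
  case: (Z w) Bw => [z|_|//].
    by rewrite lte_fin => Bz; exists z.
  by exists (bound w + 1); rewrite ?leey// ltrDl.
have [q] := rat_in_itvoo Bz; rewrite in_itv/= => /andP[Bq qz].
(* Rounding each [V e] up by less than half the gap keeps the average below [ratr q]. *)
have Vrat e : {r : rat | V e < ratr r < V e + ((ratr q - bound w) / 2)}.
  apply: cid; have [|r] := @rat_in_itvoo R (V e) (V e + ((ratr q - bound w) / 2)).
    by rewrite ltrDl divr_gt0// subr_gt0.
  by rewrite in_itv/=; exists r.
exists ([ffun e => sval (Vrat e)], q) => //; split.
  split=> [e|] /=.
    rewrite ffunE; have /andP[/ltW + _] := svalP (Vrat e); apply: le_trans.
    exact: le_trans (Vle e _ ball0).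
  apply: (@le_lt_trans _ _ (sign_avg (V \+ fun=> (ratr q - bound w) / 2))).
    apply: sign_avg_le => e; rewrite ffunE.
    by have /andP[_ /ltW] := svalP (Vrat e).
  by rewrite sign_avgD sign_avg_cst; lra.
split=> /=; last by apply: le_trans zZ; rewrite lee_fin ltW.
move=> e k; rewrite ffunE; have /andP[/ltW + _] := svalP (Vrat e).
exact/le_trans/Vle/ballD.
Qed.
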